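(* Let $(R,\mathfrak m)$ be a $1$-dimensional Cohen--Macaulay local ring with a canonical module $\omega_R$, and let $0\to M_1\to M\to M_2\to 0$ be a short exact sequence of finitely generated $R$-modules of projective dimension at most one. The following holds: (a) The induced sequence $\zeta: 0\to M_1\otimes_R\omega_R\to M\otimes_R\omega_R\to M_2\otimes_R\omega_R\to 0$ is exact. (b) If $\operatorname{tor}(M\otimes_R\omega_R)\cong\operatorname{tor}(M_1\otimes_R\omega_R)\oplus\operatorname{tor}(M_2\otimes_R\omega_R)$, then $\zeta$ splits.
   Context: Rings are commutative and noetherian. For an $R$-module $L$, $\operatorname{tor}(L)$ denotes its torsion submodule, consisting of the elements annihilated by some non-zerodivisor of $R$ (over a $1$-dimensional Cohen--Macaulay local ring this equals $H^0_{\mathfrak m}(L)$). The projective dimension bound applies to each of $M_1,M,M_2$. *)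

(* Defs.v *)
From HB Require Import structures.
From mathcomp Require Import all_boot all_algebra.
From mathcomp Require Import boolp.
From mathcomp Require Import freeg.

Set Implicit Arguments.
Unset Strict Implicit.
Unset Printing Implicit Defensive.

Import GRing.Theory.
Local Open Scope ring_scope.

(* A [submodClosed V] is a boolean predicate closed under the module operations.
   With the classical axioms of boolp every subset is given by a boolean
   predicate, so quantifying over [submodClosed V] covers all submodules. *)

Section Submodule.
Variables (R : comNzRingType) (V : lmodType R) (S : submodClosed V).

Record submod := Submod { submod_val : V; submod_valP : submod_val \in S }.

HB.instance Definition _ := [isSub for submod_val].
HB.instance Definition _ := [Choice of submod by <:].
HB.instance Definition _ := [SubChoice_isSubLmodule of submod by <:].

Lemma submod_val_linear : linear submod_val.
Proof. exact: (linearP (val : submod -> V)). Qed.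

HB.instance Definition _ :=
  GRing.isLinear.Build R submod V *:%R submod_val submod_val_linear.

End Submodule.

Section QuotientModule.
Variables (R : comNzRingType) (V : lmodType R) (S : submodClosed V).

(* [submodClosed] does not inherit from [zmodClosed], which [Quotient.quot]
   requires. *)
Definition zmod_part : {pred V} := S.

Lemma zmod_part_closed : zmod_closed zmod_part.
Proof. exact: GRing.subsemimod_closedB (GRing.subsemimodClosedP S). Qed.

HB.instance Definition _ := GRing.isZmodClosed.Build V zmod_part zmod_part_closed.

Definition quotmod := (Quotient.quot zmod_part).

HB.instance Definition _ := GRing.Zmodule.on quotmod.

Definition qproj (x : V) : quotmod := \pi_((Quotient.quot zmod_part))%qT x.

Lemma qproj_eq x y : (qproj x = qproj y) <-> (x - y \in S).
Proof.
rewrite -[x - y \in S]/(x - y \in zmod_part) Quotient.idealrBE.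
by split => /eqP.
Qed.

Lemma qproj_surj (z : quotmod) : exists x, qproj x = z.
Proof. by exists (repr z); rewrite /qproj reprK. Qed.

Lemma qproj_zmod_morphism : zmod_morphism qproj.
Proof. by move=> x y; rewrite /qproj raddfB. Qed.

HB.instance Definition _ :=
  GRing.isZmodMorphism.Build V quotmod qproj qproj_zmod_morphism.

Definition qscale (a : R) (z : quotmod) : quotmod := qproj (a *: repr z).

Lemma qscaleE a x : qscale a (qproj x) = qproj (a *: x).
Proof.
apply/qproj_eq; rewrite -scalerBr rpredZ //.
by apply/qproj_eq; rewrite /qproj reprK.
Qed.

Lemma qscaleA a b z : qscale a (qscale b z) = qscale (a * b) z.
Proof. by have [x <-] := qproj_surj z; rewrite !qscaleE scalerA. Qed.

Lemma qscale1 z : qscale 1 z = z.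
Proof. by have [x <-] := qproj_surj z; rewrite !qscaleE scale1r. Qed.

Lemma qscaleDr a : {morph qscale a : y z / y + z}.
Proof.
move=> y z; have [x <-] := qproj_surj y; have [x' <-] := qproj_surj z.
by rewrite -raddfD !qscaleE scalerDr raddfD.
Qed.

Lemma qscaleDl z : {morph qscale^~ z : a b / a + b}.
Proof.
by move=> a b; have [x <-] := qproj_surj z; rewrite !qscaleE scalerDl raddfD.
Qed.

HB.instance Definition _ := GRing.Zmodule_isLmodule.Build R quotmod
  qscaleA qscale1 qscaleDr qscaleDl.

Lemma qproj_scalable : scalable qproj.
Proof. by move=> a x; rewrite -qscaleE. Qed.

HB.instance Definition _ :=
  GRing.isScalable.Build R V quotmod *:%R qproj qproj_scalable.

End QuotientModule.

Section KernelImage.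
Variables (R : comNzRingType) (U V : lmodType R) (f : {linear U -> V}).

Definition linker : {pred U} := [pred x | f x == 0].

Lemma linker_submod : submod_closed linker.
Proof.
split=> [|a x y]; rewrite !inE ?linear0 // => /eqP fx /eqP fy.
by rewrite linearP fx fy scaler0 addr0.
Qed.

HB.instance Definition _ := GRing.isSubmodClosed.Build R U linker linker_submod.

Definition linim : {pred V} := [pred y | `[< exists x, f x = y >]].

Lemma linim_submod : submod_closed linim.
Proof.
split=> [|a x y]; first by apply/asboolP; exists 0; rewrite linear0.
move=> /asboolP[u fu] /asboolP[v fv]; apply/asboolP.
by exists (a *: u + v); rewrite linearP fu fv.
Qed.

HB.instance Definition _ := GRing.isSubmodClosed.Build R V linim linim_submod.

End KernelImage.

Section Span.
Variables (R : comNzRingType) (V : lmodType R) (A : V -> Prop).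

Definition lspan : {pred V} := [pred x |
  `[< forall S : submodClosed V, (forall y, A y -> y \in S) -> x \in S >]].

Lemma lspan_submod : submod_closed lspan.
Proof.
split=> [|a x y]; first by apply/asboolP => S _; exact: rpred0.
move=> /asboolP xA /asboolP yA; apply/asboolP => S AS.
by rewrite rpredD ?rpredZ ?xA ?yA.
Qed.

HB.instance Definition _ := GRing.isSubmodClosed.Build R V lspan lspan_submod.

Lemma lspan_gen x : A x -> x \in lspan.
Proof. by move=> Ax; apply/asboolP => S; exact. Qed.

End Span.

Section Preimage.
Variables (R : comNzRingType) (U V : lmodType R).
Variables (f : {linear U -> V}) (S : submodClosed V).

Definition preimage : {pred U} := [pred x | f x \in S].

Lemma preimage_submod : submod_closed preimage.
Proof.
split=> [|a x y]; rewrite !inE ?linear0 ?rpred0 // => xS yS.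
by rewrite linearP rpredD ?rpredZ.
Qed.

HB.instance Definition _ :=
  GRing.isSubmodClosed.Build R U preimage preimage_submod.

End Preimage.

Section Torsion.
Variables (R : comNzRingType) (L : lmodType R).

Definition torsion : {pred L} :=
  [pred x | `[< exists r : R, GRing.lreg r /\ r *: x = 0 >]].

Lemma torsion_submod : submod_closed torsion.
Proof.
split=> [|a x y].
  by apply/asboolP; exists 1; split; [exact: lreg1 | rewrite scaler0].
move=> /asboolP[r [rreg rx]] /asboolP[s [sreg sy]]; apply/asboolP.
exists (r * s); split; first exact: lregM.
have -> : r * s *: (a *: x + y) = (s * a) *: (r *: x) + r *: (s *: y).
  by rewrite scalerDr !scalerA -mulrA mulrC.
by rewrite rx sy !scaler0 addr0.
Qed.

HB.instance Definition _ :=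
  GRing.isSubmodClosed.Build R L torsion torsion_submod.

Definition tor : lmodType R := submod torsion.

End Torsion.

Section Hom.
Variables (R : comNzRingType) (U V : lmodType R).
Implicit Types f g h : {linear U -> V}.

HB.instance Definition _ := gen_eqMixin {linear U -> V}.
HB.instance Definition _ := gen_choiceMixin {linear U -> V}.

Lemma hom_eq f g : f =1 g -> f = g.
Proof.
case: f g => [f [[fD] [fZ]]] [g [[gD] [gZ]]] /= fg.
have {}fg : f = g by apply/funext.
rewrite -{}fg in gD gZ *.
by rewrite (Prop_irrelevance fD gD) (Prop_irrelevance fZ gZ).
Qed.

Definition hom_zero : {linear U -> V} := \0.
Definition hom_opp f : {linear U -> V} := \- f.
Definition hom_add f g : {linear U -> V} := f \+ g.
Definition hom_scale (a : R) f : {linear U -> V} := a \*: f.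

Lemma hom_addA : associative hom_add.
Proof. by move=> f g h; apply: hom_eq => x /=; rewrite addrA. Qed.

Lemma hom_addC : commutative hom_add.
Proof. by move=> f g; apply: hom_eq => x /=; rewrite addrC. Qed.

Lemma hom_add0 : left_id hom_zero hom_add.
Proof. by move=> f; apply: hom_eq => x /=; rewrite add0r. Qed.

Lemma hom_addN : left_inverse hom_zero hom_opp hom_add.
Proof. by move=> f; apply: hom_eq => x /=; rewrite addNr. Qed.

HB.instance Definition _ := GRing.isZmodule.Build {linear U -> V}
  hom_addA hom_addC hom_add0 hom_addN.

Lemma hom_scaleA a b f : hom_scale a (hom_scale b f) = hom_scale (a * b) f.
Proof. by apply: hom_eq => x /=; rewrite scalerA. Qed.

Lemma hom_scale1 f : hom_scale 1 f = f.
Proof. by apply: hom_eq => x /=; rewrite scale1r. Qed.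

Lemma hom_scaleDr a : {morph hom_scale a : f g / f + g}.
Proof. by move=> f g; apply: hom_eq => x /=; rewrite scalerDr. Qed.

Lemma hom_scaleDl f : {morph hom_scale^~ f : a b / a + b}.
Proof. by move=> a b; apply: hom_eq => x /=; rewrite scalerDl. Qed.

HB.instance Definition _ := GRing.Zmodule_isLmodule.Build R {linear U -> V}
  hom_scaleA hom_scale1 hom_scaleDr hom_scaleDl.

End Hom.

Section Precomposition.
Variables (R : comNzRingType) (U U' V : lmodType R) (d : {linear U' -> U}).

Definition precomp (g : {linear U -> V}) : {linear U' -> V} := g \o d.

Lemma precomp_linear : linear precomp.
Proof. by move=> a g h; apply: hom_eq. Qed.

HB.instance Definition _ := GRing.isLinear.Build R
  {linear U -> V} {linear U' -> V} *:%R precomp precomp_linear.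

End Precomposition.

Section TensorProduct.
Variables (R : comNzRingType) (M N : lmodType R).

Local Notation free := {freeg (M * N)%type / R}.
Local Notation "[ x , y ]" := (<< (x, y) >> : free).

(* Taking a = 1, and then x' = 0 (resp. y' = 0), these give all the relations of
   the tensor product. *)
Inductive tensor_rel : free -> Prop :=
| TensorRelL a x x' y :
    tensor_rel ([a *: x + x', y] - (a *: [x, y] + [x', y]))
| TensorRelR a x y y' :
    tensor_rel ([x, a *: y + y'] - (a *: [x, y] + [x, y'])).

Definition tensor : lmodType R := quotmod (lspan tensor_rel).

Definition tens (x : M) (y : N) : tensor := qproj (lspan tensor_rel) [x, y].

Lemma tens_linearl y : linear (tens^~ y).
Proof.
move=> a x x'; rewrite /tens -linearP; apply/qproj_eq/lspan_gen.
exact: TensorRelL.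
Qed.

Lemma tens_linearr x : linear (tens x).
Proof.
move=> a y y'; rewrite /tens -linearP; apply/qproj_eq/lspan_gen.
exact: TensorRelR.
Qed.

HB.instance Definition _ := bilinear_isBilinear.Build R M N tensor
  *:%R *:%R tens (tens_linearl, tens_linearr).

End TensorProduct.

Section FreeLift.
Variables (R : nzRingType) (K : choiceType) (L : lmodType R) (f : K -> L).

Lemma fglift_zmod_morphism : zmod_morphism (fglift f).
Proof. exact: lift_is_additive. Qed.

HB.instance Definition _ :=
  GRing.isZmodMorphism.Build {freeg K / R} L (fglift f) fglift_zmod_morphism.

Let fgliftD (D E : {freeg K / R}) : fglift f (D + E) = fglift f D + fglift f E.
Proof. exact: raddfD. Qed.

Let freegZD (a : R) (D E : {freeg K / R}) : a *: (D + E) = a *: D + a *: E.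
Proof. exact: scalerDr. Qed.

Lemma fglift_scale (a : R) (D : {freeg K / R}) :
  fglift f (a *: D) = a *: fglift f D.
Proof.
have Z s (c : K -> R) : fglift f (a *: \sum_(z <- s) << c z *g z >>)
    = a *: fglift f (\sum_(z <- s) << c z *g z >>).
  elim: s => [|z s IHs]; first by rewrite big_nil scaler0 raddf0 scaler0.
  rewrite big_cons freegZD !fgliftD IHs scalerDr; congr (_ + _).
  rewrite liftU scalerA -liftU; congr fglift.
  by apply/eqP/freeg_eqP => x; rewrite coeffZ !coeffU mulrA.
by move: (Z (dom D) (fun z => coeff z D)); rewrite freeg_sumE.
Qed.

Lemma fglift_scalable : scalable (fglift f).
Proof. exact: fglift_scale. Qed.

HB.instance Definition _ :=
  GRing.isScalable.Build R {freeg K / R} L *:%R (fglift f) fglift_scalable.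

End FreeLift.

Section TensorLift.
Variables (R : comNzRingType) (M N L : lmodType R).
Variable b : {bilinear M -> N -> L}.

Let bfree (D : {freeg (M * N)%type / R}) : L :=
  fglift (fun xy : M * N => b xy.1 xy.2) D.

Definition tensor_lift (t : tensor M N) : L :=
  fglift (fun xy : M * N => b xy.1 xy.2) (repr t).

Let bfree_rel D : D \in lspan (@tensor_rel R M N) -> bfree D = 0.
Proof.
move=> /asboolP /(_ (linker (fglift (fun xy : M * N => b xy.1 xy.2)))) H.
apply/eqP; apply: H => {D} _ [a x x' y|a x y y']; rewrite inE;
  rewrite linearB linearP /= !liftU !scale1r /= subr_eq0; apply/eqP.
- exact: linearPl.
- exact: linearPr.
Qed.

Lemma tensor_liftE D : tensor_lift (qproj _ D) = bfree D.
Proof.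
apply/eqP; rewrite -subr_eq0 /tensor_lift -linearB; apply/eqP/bfree_rel.
by apply/qproj_eq; rewrite /qproj reprK.
Qed.

Lemma tensor_lift_linear : linear tensor_lift.
Proof.
move=> a t t'; have [D <-] := qproj_surj t; have [D' <-] := qproj_surj t'.
by rewrite -linearP !tensor_liftE /bfree linearP.
Qed.

HB.instance Definition _ := GRing.isLinear.Build R (tensor M N) L *:%R
  tensor_lift tensor_lift_linear.

Lemma tensor_lift_tens x y : tensor_lift (tens x y) = b x y.
Proof. by rewrite tensor_liftE /bfree liftU scale1r. Qed.

End TensorLift.

Section TensorMap.
Variables (R : comNzRingType) (M M' N L : lmodType R).

Lemma tensor_ext (f g : {linear tensor M N -> L}) :
  (forall x y, f (tens x y) = g (tens x y)) -> f =1 g.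
Proof.
move=> fg t; have [D <-] := qproj_surj t.
rewrite -[D]freeg_sumE !raddf_sum; apply: eq_bigr => -[x y] _.
set c := coeff _ D.
have -> : << c *g (x, y) >> = c *: << (x, y) >> :> {freeg (M * N)%type / R}.
  by apply/eqP/freeg_eqP => z; rewrite coeffZ !coeffU mul1r.
have Q (D' : {freeg (M * N)%type / R}) :
    qproj (lspan (@tensor_rel R M N)) (c *: D') = c *: qproj _ D'.
  exact: linearZ.
have F (h : {linear tensor M N -> L}) u : h (c *: u) = c *: h u.
  exact: linearZ.
by rewrite /= Q !F; congr (_ *: _); exact: fg.
Qed.

Variable f : {linear M -> M'}.

Definition tens_comp (x : M) (y : N) : tensor M' N := tens (f x) y.

Lemma tens_comp_bilinear : bilinear_for *:%R *:%R tens_comp.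
Proof.
split=> [y a x x'|x a y y']; first by rewrite /tens_comp linearP linearPl.
by rewrite /tens_comp linearPr.
Qed.

HB.instance Definition _ := bilinear_isBilinear.Build R M N (tensor M' N)
  *:%R *:%R tens_comp tens_comp_bilinear.

Definition tensor_map : {linear tensor M N -> tensor M' N} :=
  tensor_lift tens_comp.

Lemma tensor_map_tens x y : tensor_map (tens x y) = tens (f x) y.
Proof. exact: tensor_lift_tens. Qed.

End TensorMap.

Section Homological.
Variable R : comNzRingType.

Definition isom (U V : lmodType R) : Prop :=
  exists f : {linear U -> V}, bijective f.

Definition surjective (U V : lmodType R) (f : U -> V) : Prop :=
  forall y, exists x, f x = y.

Definition exact_at (U V W : lmodType R) (f : U -> V) (g : V -> W) : Prop :=
  forall y, g y = 0 <-> exists x, f x = y.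

Definition short_exact (U V W : lmodType R) (f : U -> V) (g : V -> W) : Prop :=
  [/\ injective f, exact_at f g & surjective g].

Definition split_sequence (U V W : lmodType R)
    (f : {linear U -> V}) (g : {linear V -> W}) : Prop :=
  short_exact f g /\ exists s : {linear W -> V}, cancel s g.

Definition fin_gen (M : lmodType R) : Prop :=
  exists n (v : 'I_n -> M),
    forall x, exists c : 'I_n -> R, x = \sum_(i < n) c i *: v i.

Definition projective (P : lmodType R) : Prop :=
  forall (U V : lmodType R) (g : {linear U -> V}) (f : {linear P -> V}),
    surjective g -> exists h : {linear P -> U}, forall x, g (h x) = f x.

Definition injective_module (I : lmodType R) : Prop :=
  forall (U V : lmodType R) (g : {linear U -> V}) (f : {linear U -> I}),
    injective g -> exists h : {linear V -> I}, forall x, h (g x) = f x.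

Definition projective_resolution (M : lmodType R) (P : nat -> lmodType R)
    (d : forall n, {linear P n.+1 -> P n}) (eps : {linear P 0 -> M}) : Prop :=
  [/\ forall n, projective (P n), surjective eps, exact_at (d 0) eps
    & forall n, exact_at (d n.+1) (d n)].

Definition injective_resolution (M : lmodType R) (I : nat -> lmodType R)
    (d : forall n, {linear I n -> I n.+1}) (eta : {linear M -> I 0}) : Prop :=
  [/\ forall n, injective_module (I n), injective eta, exact_at eta (d 0)
    & forall n, exact_at (d n) (d n.+1)].

Definition projdim_le (M : lmodType R) (n : nat) : Prop :=
  exists P d eps, @projective_resolution M P d eps /\
    forall i, (n < i)%N -> forall x : P i, x = 0.

Definition injdim_le (M : lmodType R) (n : nat) : Prop :=
  exists I d eta, @injective_resolution M I d eta /\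
    forall i, (n < i)%N -> forall x : I i, x = 0.

Section Cohomology.
Variables (P : nat -> lmodType R) (d : forall n, {linear P n.+1 -> P n}).
Variable N : lmodType R.

Definition cocycles (i : nat) : submodClosed {linear P i -> N} :=
  linker (@precomp _ _ _ N (d i)).

(* In degree 0 the kernel of the identity is the zero submodule. *)
Definition coboundaries (i : nat) : submodClosed {linear P i -> N} :=
  match i with
  | 0 => linker (@idfun {linear P 0 -> N})
  | j.+1 => linim (@precomp _ _ _ N (d j))
  end.

Definition hom_cohomology (i : nat) : lmodType R :=
  quotmod (preimage (@submod_val _ _ (cocycles i)) (coboundaries i)).

End Cohomology.

(* Ext^i(M, N) is defined up to isomorphism, by a projective resolution of M:
   [is_Ext i M N E] says that Ext^i(M, N) is isomorphic to E. *)
Definition is_Ext (i : nat) (M N E : lmodType R) : Prop :=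
  exists P d eps, @projective_resolution M P d eps /\
    isom (hom_cohomology d N i) E.

End Homological.

Section LocalAlgebra.
Variable R : comNzRingType.

Definition ideal := submodClosed R^o.

Definition noetherian : Prop := forall J : ideal, fin_gen (submod J).

Definition prime_ideal (p : ideal) : Prop :=
  (1 : R) \notin p /\ prime_idealr_closed (p : {pred R}).

Definition maximal_ideal (m : ideal) : Prop :=
  (1 : R) \notin m /\
  forall J : ideal, (1 : R) \notin J -> {subset m <= J} -> J =i m.

Definition local_ring (m : ideal) : Prop :=
  maximal_ideal m /\ forall n : ideal, maximal_ideal n -> n =i m.

Definition prime_chain (n : nat) : Prop :=
  exists p : nat -> ideal, (forall i, (i <= n)%N -> prime_ideal (p i)) /\
    forall i, (i < n)%N -> {subset p i <= p i.+1} /\ ~ (p i =i p i.+1).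

Definition krull_dim (n : nat) : Prop :=
  prime_chain n /\ forall k, prime_chain k -> (k <= n)%N.

Variable m : ideal.

Definition residue_field : lmodType R := quotmod m.

Section Homothety.
Variables (M : lmodType R) (a : R).

Definition homothety (x : M) : M := a *: x.

Lemma homothety_linear : linear homothety.
Proof.
by move=> b x y; rewrite /homothety scalerDr !scalerA mulrC.
Qed.

HB.instance Definition _ :=
  GRing.isLinear.Build R M M *:%R homothety homothety_linear.

End Homothety.

(* Uses M/(a_1, ..., a_n)M = (M/a_1 M)/(a_2, ..., a_n)(M/a_1 M).  The base case
   says that the final quotient is nonzero. *)
Fixpoint regular_sequence (M : lmodType R) (s : seq R) : Prop :=
  match s with
  | [::] => exists x : M, x != 0
  | a :: s' => injective (@homothety M a) /\
               regular_sequence (quotmod (linim (@homothety M a))) s'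
  end.

(* The supremum of the lengths of the M-regular sequences in m; the zero module
   has no depth. *)
Definition depth (M : lmodType R) (n : nat) : Prop :=
  (exists s : seq R, [/\ size s = n, {subset s <= m} & regular_sequence M s]) /\
  forall s : seq R, {subset s <= m} -> regular_sequence M s ->
    (size s <= n)%N.

Definition maximal_cohen_macaulay (M : lmodType R) : Prop :=
  fin_gen M /\ exists d, krull_dim d /\ depth M d.

Definition cohen_macaulay_ring : Prop := maximal_cohen_macaulay R^o.

(* The type is dim_k Ext^t(k, M), with k the residue field and t the depth
   of M; this Ext is a k-vector space, so dimension r means isomorphic to k^r
   as an R-module. *)
Definition cm_type (M : lmodType R) (r : nat) : Prop :=
  exists t, depth M t /\ is_Ext t residue_field M {ffun 'I_r -> residue_field}.

(* A maximal Cohen-Macaulay module of type 1 and finite injective dimension. *)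
Definition canonical_module (omega : lmodType R) : Prop :=
  [/\ maximal_cohen_macaulay omega, cm_type omega 1
    & exists n, injdim_le omega n].

End LocalAlgebra.

(* Main.v *)
(** Presenting M2 by finitely generated projectives 0 -> K -> F -> M2 -> 0, (a)
    amounts to the injectivity of K (x) omega -> F (x) omega.  A nonzero kernel
    has an element whose annihilator is a prime p; since omega is torsion-free
    and dim R = 1, p is a minimal prime, hence the annihilator of some y in R,
    and functionals omega[p] -> R y transport the kernel element to the kernel
    of K -> F.

    For (b), write Ai = Mi (x) omega, A = M (x) omega and T for torsion.
    Counting lengths in 0 -> Hom(T A2, T A1) -> Hom(T A2, T A) -> Hom(T A2, T A2)
    shows that the last map is onto, so T A2 lifts to A.  The obstruction to
    extending the resulting splitting over T A2 to A2 lies in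
    Ext^1(A2 / T A2, A1), which vanishes: A2 / T A2 is torsion-free, A1 is the
    cokernel of a map between direct summands of powers of omega, and
    Ext^i(C, omega) = 0 for i > 0 and C torsion-free, by descending induction on
    i from the injective dimension of omega, with Nakayama's lemma at each
    step. *)

From HB Require Import structures.
Require Import Defs.
From mathcomp Require Import all_boot all_algebra.
From mathcomp Require Import boolp ring.

Set Implicit Arguments.
Unset Strict Implicit.
Unset Printing Implicit Defensive.

Import GRing.Theory.
Local Open Scope ring_scope.

(** * Linear maps and submodules from predicates *)

(** The isomorphism assumed in (b) is abstract and need not respect the maps of the sequence, so
    only numerical information can be drawn from it; this is why lengths appear. They are finite
    because a finitely generated torsion module is filtered by copies of R/m.

    In (a), the element y with annihilator p replaces localization at p: R y is a copy of R/p inside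
    R, and linear functionals into it detect nonzero elements of omega[p]. The same injectivity,
    applied to a presentation of M1, makes A1 the cokernel of an injective map between summands of
    powers of omega, so that Ext^1(-, A1) is controlled by Ext(-, omega).

    The descending induction needs the vanishing of Ext for torsion modules one degree higher. It
    comes from a regular x in m: R/m embeds in R/xR, whose Ext into omega vanishes from degree 2 on.

    Ext(-, omega) is never formed as a module here: vanishing and finite generation are stated on
    cocycles in a fixed injective resolution of omega. *)

Section Tools.
Variable R : comNzRingType.

Section PropSubmodule.
Variables (V : lmodType R) (P : V -> Prop).
Hypotheses (P0 : P 0) (PL : forall a x y, P x -> P y -> P (a *: x + y)).

Definition prop_pred : {pred V} := [pred x | `[< P x >]].

Lemma prop_pred_closed : submod_closed prop_pred.
Proof.
split=> [|a x y]; first exact/asboolP.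
by move=> /asboolP Px /asboolP Py; apply/asboolP/PL.
Qed.

Definition prop_submod : submodClosed V :=
  HB.pack_for (submodClosed V) prop_pred
    (GRing.isSubmodClosed.Build R V prop_pred prop_pred_closed).

Lemma prop_submodP x : reflect (P x) (x \in prop_submod).
Proof. exact: asboolP. Qed.

End PropSubmodule.

Lemma prop_submod_ex (V : lmodType R) (P : V -> Prop) :
  P 0 -> (forall a x y, P x -> P y -> P (a *: x + y)) ->
  exists S : submodClosed V, forall x, x \in S <-> P x.
Proof.
move=> P0 PL; exists (prop_submod P0 PL) => x.
by split=> [/prop_submodP|/prop_submodP].
Qed.

Lemma submodN (V : lmodType R) (S : submodClosed V) x : x \in S -> - x \in S.
Proof. by rewrite -scaleN1r => /rpredZ; apply. Qed.

Lemma submodB (V : lmodType R) (S : submodClosed V) x y :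
  x \in S -> y \in S -> x - y \in S.
Proof. by move=> xS yS; rewrite rpredD ?submodN. Qed.

Lemma linear_ex (U V : lmodType R) (f : U -> V) :
  linear f -> exists g : {linear U -> V}, g =1 f.
Proof.
move=> fL; exists (HB.pack_for {linear U -> V} f
   (GRing.isLinear.Build R U V *:%R f fL)).
by [].
Qed.

(** Additivity reduces single-valuedness to the value at 0: two values of the same element differ by
    a value of 0. *)
Lemma linear_of_rel (U V : lmodType R) (G : U -> V -> Prop) :
  (forall x, exists y, G x y) ->
  (forall a x x' y y', G x y -> G x' y' -> G (a *: x + x') (a *: y + y')) ->
  (forall y, G 0 y -> y = 0) ->
  exists f : {linear U -> V}, forall x y, G x y -> f x = y.
Proof.
move=> Gtot GL G0; have [f fG] := choice Gtot.
have Gfun x y y' : G x y -> G x y' -> y = y'.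
  move=> xy xy'; apply/eqP; rewrite -subr_eq0; apply/eqP/G0.
  by have := GL (-1) _ _ _ _ xy' xy; rewrite !scaleN1r addNr addrC.
have [|g gf] := @linear_ex U V f.
  by move=> a x y; apply: Gfun (fG _) _; apply: GL.
by exists g => x y xy; rewrite gf; apply: Gfun (fG _) xy.
Qed.

Lemma factor_surj (U V W : lmodType R) (p : {linear U -> V})
    (h : {linear U -> W}) :
  Defs.surjective p -> (forall x, p x = 0 -> h x = 0) ->
  exists h' : {linear V -> W}, forall x, h' (p x) = h x.
Proof.
move=> ps ph.
have [|||h' h'E] := @linear_of_rel V W (fun v w => exists2 x, p x = v & h x = w).
- by move=> v; have [x xv] := ps v; exists (h x), x.
- move=> a _ _ _ _ [x <- <-] [x' <- <-].
  by exists (a *: x + x'); rewrite linearP.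
- by move=> w [x /ph hx0 <-].
by exists h' => x; apply: h'E; exists x.
Qed.

Lemma factor_inj (U V W : lmodType R) (i : {linear U -> V})
    (h : {linear W -> V}) :
  injective i -> (forall x, exists y, i y = h x) ->
  exists h' : {linear W -> U}, forall x, i (h' x) = h x.
Proof.
move=> iI ih.
have [|||h' h'E] := @linear_of_rel W U (fun w u => i u = h w).
- exact: ih.
- by move=> a x x' y y' e e'; rewrite !linearP e e'.
- by move=> y; rewrite linear0 => iy; apply: iI; rewrite iy linear0.
exists h' => x; have [y yx] := ih x.
by rewrite (h'E x y) ?yx.
Qed.

Lemma linear_inj (U V : lmodType R) (f : {linear U -> V}) :
  (forall x, f x = 0 -> x = 0) -> injective f.
Proof.
move=> f0 x y fxy; apply/eqP; rewrite -subr_eq0; apply/eqP/f0.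
by rewrite linearB fxy subrr.
Qed.

Lemma linear_sub_ex (U V : lmodType R) (f g : {linear U -> V}) :
  exists h : {linear U -> V}, forall x, h x = f x - g x.
Proof.
apply: linear_ex => a x y.
by rewrite (linearP f) (linearP g) opprD scalerBr addrACA.
Qed.

End Tools.

(** * Noetherian modules *)

Section Noetherian.
Variable R : comNzRingType.

Definition finitely_spanned (V : lmodType R) (S : submodClosed V) : Prop :=
  exists s : seq V, {subset s <= S} /\
    forall T : submodClosed V, {subset s <= T} -> {subset S <= T}.

Definition noetherian_module (V : lmodType R) : Prop :=
  forall S : submodClosed V, finitely_spanned S.

Lemma fin_genP (V : lmodType R) : fin_gen V <->
  exists s : seq V, forall T : submodClosed V, {subset s <= T} -> forall x, x \in T.
Proof.
split=> [[n [v vE]]|[s sV]].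
  exists [seq v i | i : 'I_n] => T sT x; have [c ->] := vE x.
  apply: rpred_sum => i _; apply: rpredZ; apply: sT.
  exact: image_f.
exists (size s), (fun i => s`_i).
have [||S SP] := @prop_submod_ex R V
  (fun x => exists c : 'I_(size s) -> R, x = \sum_(i < size s) c i *: s`_i).
- by exists (fun=> 0); rewrite big1 // => i _; rewrite scale0r.
- move=> a _ _ [c ->] [c' ->]; exists (fun i => a * c i + c' i).
  rewrite scaler_sumr -big_split; apply: eq_bigr => i _ /=.
  by rewrite scalerDl scalerA.
move=> x; apply/SP; apply: sV => y /(nthP 0) [i i_s <-]; apply/SP.
exists (fun j => (j == Ordinal i_s)%:R).
rewrite (bigD1 (Ordinal i_s)) //= eqxx scale1r big1 ?addr0 // => j /negPf ->.
by rewrite scale0r.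
Qed.

Lemma fin_gen_submod (V : lmodType R) (S : submodClosed V) :
  fin_gen (submod S) <-> finitely_spanned S.
Proof.
split=> [/fin_genP [s sS]|[s [sS sE]]].
  exists [seq submod_val y | y <- s]; split=> [_ /mapP [y _ ->]|T sT x xS].
    exact: submod_valP.
  have := sS (preimage (@submod_val _ _ S) T) _ (Submod xS); apply.
  by move=> y ys; apply: sT; apply: map_f.
apply/fin_genP; exists (pmap insub s) => T sT x.
have [||T' T'P] := @prop_submod_ex R V
  (fun y => exists2 z : submod S, z \in T & submod_val z = y).
- by exists 0; rewrite ?rpred0 ?linear0.
- move=> a _ _ [z zT <-] [z' zT' <-]; exists (a *: z + z').
    by rewrite rpredD ?rpredZ.
  by rewrite linearP.
have /T'P [z zT zx] : submod_val x \in T'.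
  apply: sE (submod_valP x) => y ys; apply/T'P.
  exists (Submod (sS y ys)) => //; apply: sT.
  by rewrite mem_pmap_sub.
by rewrite -(val_inj (zx : val z = val x)).
Qed.

Lemma fin_gen_surj (V W : lmodType R) (p : {linear V -> W}) :
  Defs.surjective p -> fin_gen V -> fin_gen W.
Proof.
move=> ps [n [v vE]]; exists n, (fun i => p (v i)) => y.
have [x <-] := ps y; have [c ->] := vE x; exists c.
by rewrite linear_sum; apply: eq_bigr => i _; rewrite linearZ.
Qed.

Hypothesis noethR : noetherian R.

(** Induction on [s]: the coefficients of the head [v] in elements of [S] form an ideal [J], and
    lifts of generators of [J], together with generators of the part of [S] spanned by the tail,
    span [S]. *)
Lemma span_noetherian (V : lmodType R) (s : seq V) (S : submodClosed V) :
  {subset S <= lspan (fun x => x \in s)} -> finitely_spanned S.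
Proof.
elim: s S => [|v s IH] S SE.
  exists [::]; split=> // T _ x /SE /asboolP /(_ T) H.
  exact: H.
pose U : submodClosed V := lspan (fun x => x \in s).
have [||J JP] := @prop_submod_ex R R^o
  (fun a => exists2 u, u \in U & (a : R) *: v + u \in S).
- by exists 0; rewrite ?rpred0 // scale0r addr0 rpred0.
- move=> b a a' [u uU uS] [u' u'U u'S]; exists (b *: u + u').
    by rewrite rpredD ?rpredZ.
  have -> : (b *: a + a' : R^o) *: v + (b *: u + u') =
      b *: (a *: v + u) + (a' *: v + u').
    by rewrite scalerDl scalerDr scalerA addrACA.
  by rewrite rpredD ?rpredZ.
have [||SU SUP] := @prop_submod_ex R V (fun x => x \in S /\ x \in U).
- by rewrite !rpred0.
- by move=> a x y [? ?] [? ?]; split; rewrite rpredD ?rpredZ.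
have [|t [tSU tE]] := IH SU; first by move=> x /SUP [].
have [l [lJ lE]] : finitely_spanned J by apply/fin_gen_submod; exact: noethR.
have [r [rS rE]] : exists r : seq V, {subset r <= S} /\
    forall a, a \in l -> exists2 x, x \in r & x - (a : R) *: v \in U.
  elim: l lJ {lE} => [|a l IHl] lJ; first by exists [::].
  have [|r [rS rE]] := IHl; first by move=> b bl; apply: lJ; rewrite inE bl orbT.
  have /JP [u uU uS] := lJ a (mem_head _ _).
  exists (a *: v + u :: r); split=> [x|b].
    by rewrite inE => /predU1P [->|/rS].
  rewrite inE => /predU1P [->|/rE [x xr xU]].
    by exists (a *: v + u); rewrite ?mem_head // addrC addKr.
  by exists x; rewrite // inE xr orbT.
exists (r ++ t); split=> [x|T rtT x xS].
  by rewrite mem_cat => /orP [/rS|/tSU /SUP []].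
(* The coefficients of [v] already realized inside [T]; this ideal contains the generators of [J],
   hence [J]. *)
have [||J' J'P] := @prop_submod_ex R R^o
  (fun a => exists y, [/\ y \in T, y \in S & y - (a : R) *: v \in U]).
- by exists 0; rewrite !rpred0 scale0r subr0 rpred0.
- move=> b a a' [y [? ? yU]] [y' [? ? yU']]; exists (b *: y + y').
  split; [by rewrite rpredD ?rpredZ | by rewrite rpredD ?rpredZ|].
  have -> : b *: y + y' - (b *: a + a' : R^o) *: v =
      b *: (y - a *: v) + (y' - a' *: v).
    by rewrite scalerDl scalerBr scalerA opprD addrACA.
  by rewrite rpredD ?rpredZ.
have lJ' : {subset J <= J'}.
  apply: lE => a /rE [y yr yU]; apply/J'P; exists y; split=> //.
    by apply: rtT; rewrite mem_cat yr.
  exact: rS.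
have [||W WP] := @prop_submod_ex R V
  (fun x => exists2 a : R, True & x - a *: v \in U).
- by exists 0; rewrite // scale0r subr0 rpred0.
- move=> b y y' [a _ yU] [a' _ yU']; exists (b * a + a') => //.
  have -> : b *: y + y' - (b * a + a') *: v =
      b *: (y - a *: v) + (y' - a' *: v).
    by rewrite scalerDl scalerBr scalerA opprD addrACA.
  by rewrite rpredD ?rpredZ.
have /WP [a _ xU] : x \in W.
  have /asboolP := SE x xS; apply => y; rewrite inE => /predU1P [->|ys]; apply/WP.
    by exists 1; rewrite // scale1r subrr rpred0.
  by exists 0; rewrite // scale0r subr0; apply: lspan_gen.
have /lJ' /J'P [y [yT yS yU]] : a \in J.
  apply/JP; exists (x - a *: v) => //.
  by rewrite addrC subrK.
rewrite -[x](subrK y) rpredD //.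
apply: (tE T); first by move=> z zt; apply: rtT; rewrite mem_cat zt orbT.
apply/SUP; split; first exact: submodB.
by rewrite -[x - y](subrKA (a *: v)) rpredD // -opprB rpredN.
Qed.

Lemma fin_gen_noetherian (V : lmodType R) : fin_gen V -> noetherian_module V.
Proof.
move=> /fin_genP [s sV] S; apply: (@span_noetherian _ s) => x _.
by apply: sV => y; apply: lspan_gen.
Qed.

Lemma noetherian_sub (V W : lmodType R) (i : {linear W -> V}) :
  injective i -> noetherian_module V -> noetherian_module W.
Proof.
move=> iI Vn S.
have [||T TP] := @prop_submod_ex R V (fun x => exists2 y, y \in S & i y = x).
- by exists 0; rewrite ?rpred0 ?linear0.
- move=> a _ _ [y yS <-] [y' yS' <-]; exists (a *: y + y').
    by rewrite rpredD ?rpredZ.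
  by rewrite linearP.
have [t [tT tE]] := Vn T.
have [s [sS st]] : exists s : seq W, {subset s <= S} /\ t = [seq i y | y <- s].
  elim: t tT {tE} => [|x t IHt] tT; first by exists [::].
  have [|s [sS ->]] := IHt; first by move=> y yt; apply: tT; rewrite inE yt orbT.
  have /TP [y yS yx] := tT x (mem_head _ _).
  exists (y :: s); split; last by rewrite /= yx.
  by move=> z; rewrite inE => /predU1P [->|/sS].
exists s; split=> // U sU y yS.
have [||U' U'P] := @prop_submod_ex R V (fun x => exists2 y, y \in U & i y = x).
- by exists 0; rewrite ?rpred0 ?linear0.
- move=> a _ _ [z zS <-] [z' zS' <-]; exists (a *: z + z').
    by rewrite rpredD ?rpredZ.
  by rewrite linearP.
have /U'P [z zU /iI <-] // : i y \in U'.
apply: tE; last by apply/TP; exists y.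
by move=> x; rewrite st => /mapP [z zs ->]; apply/U'P; exists z => //; apply: sU.
Qed.

Lemma noetherian_fin_gen (V : lmodType R) : noetherian_module V -> fin_gen V.
Proof.
move=> Vn; have [||S SP] := @prop_submod_ex R V (fun=> True) => //.
have [s [_ sE]] := Vn S; apply/fin_genP; exists s => T sT x.
by apply: sE => //; apply/SP.
Qed.

Lemma fin_gen_sub (V W : lmodType R) (i : {linear W -> V}) :
  injective i -> fin_gen V -> fin_gen W.
Proof.
by move=> iI /fin_gen_noetherian /(noetherian_sub iI) /noetherian_fin_gen.
Qed.

(** Without a maximal member, choice yields a strictly ascending sequence; its union is finitely
    spanned, hence reached at a finite stage. *)
Lemma noetherian_max (V : lmodType R) (F : submodClosed V -> Prop) :
  noetherian_module V -> (exists S, F S) ->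
  exists2 S, F S & forall T, F T -> {subset S <= T} -> {subset T <= S}.
Proof.
move=> Vn [S0 FS0]; apply: contrapT => H.
have next (S : {S | F S}) : exists T : {S | F S},
    {subset sval S <= sval T} /\ ~ {subset sval T <= sval S}.
  apply: contrapT => nT; apply: H; exists (sval S); first exact: svalP.
  move=> T FT ST; apply: contrapT => TS; apply: nT.
  by exists (exist _ T FT).
have [f fP] := choice next.
pose c n : submodClosed V := sval (iter n f (exist _ S0 FS0)).
have cS n : {subset c n <= c n.+1} by have [] := fP (iter n f (exist _ S0 FS0)).
have cM n k : {subset c n <= c (n + k)%N}.
  by elim: k => [|k IHk]; rewrite ?addn0 ?addnS // => x /IHk /cS.
have [||U UP] := @prop_submod_ex R V (fun x => exists n, x \in c n).
- by exists 0%N; rewrite rpred0.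
- move=> a x y [n xn] [k yk]; exists (n + k)%N.
  by rewrite rpredD ?rpredZ //; [exact: cM|rewrite addnC; exact: cM].
have [s [sU sE]] := Vn U.
have [n sn] : exists n, {subset s <= c n}.
  elim: s sU {sE} => [|x s IHs] sU; first by exists 0%N.
  have [|n sn] := IHs; first by move=> y ys; apply: sU; rewrite inE ys orbT.
  have /UP [k xk] := sU x (mem_head _ _); exists (k + n)%N => y.
  by rewrite inE => /predU1P [->|/sn ny]; [exact: cM|rewrite addnC; exact: cM].
have [_] := fP (iter n f (exist _ S0 FS0)); apply => x xn.
by apply: (sE (c n)) => //; apply/UP; exists n.+1.
Qed.

End Noetherian.

(** * Prime ideals of a one-dimensional local ring *)

Section PrimeIdeals.
Variable R : comNzRingType.
Implicit Types p q J : ideal R.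

Lemma idealM J (a x : R) : x \in J -> a * x \in J.
Proof. by move=> xJ; have : a *: (x : R^o) \in J by rewrite rpredZ. Qed.

Lemma ideal0 J : (0 : R) \in J.
Proof. exact: (@rpred0 R^o J). Qed.

Lemma idealD J (x y : R) : x \in J -> y \in J -> x + y \in J.
Proof. exact: (@rpredD R^o J). Qed.

Lemma lreg0 (r x : R) : GRing.lreg r -> r * x = 0 -> x = 0.
Proof. by move=> rreg rx; apply: rreg; rewrite rx mulr0. Qed.

(** A sigma type, because the map itself is needed to define [annihilator] as its kernel. *)
Lemma scale_ex (V : lmodType R) (v : V) :
  {f : {linear R^o -> V} | forall a, f a = a *: v}.
Proof.
apply: cid; apply: (@linear_ex R R^o V (fun a => a *: v)) => a x y.
by rewrite scalerDl scalerA.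
Qed.

Definition annihilator (V : lmodType R) (v : V) : ideal R :=
  linker (sval (scale_ex v)).

Lemma annihilatorP (V : lmodType R) (v : V) a :
  a \in annihilator v <-> a *: v = 0.
Proof. by rewrite inE (svalP (scale_ex v)); split=> [/eqP|->]. Qed.

Lemma prime_idealM p (a b : R) : prime_ideal p -> a * b \in p -> a \in p \/ b \in p.
Proof. by move=> [_ H] /H /orP. Qed.

Lemma prime_ideal_exp p (f : R) n : prime_ideal p -> f ^+ n \in p -> f \in p.
Proof.
move=> pp; elim: n => [|n IHn]; first by rewrite expr0 (negPf pp.1).
by rewrite exprS => /(prime_idealM pp) [].
Qed.

(** The ideal J + R a, against which the maximality of J is tested. *)
Lemma ideal_sum_ex J (a : R) :
  exists K : ideal R, forall x : R, x \in K <-> exists r, x - r * a \in J.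
Proof.
apply: (@prop_submod_ex R R^o (fun x : R => exists r, x - r * a \in J)).
  by exists 0; rewrite mul0r subr0 ideal0.
move=> b x y [r xr] [s ys]; exists (b * r + s).
have -> : b *: x + y - (b * r + s) * a =
    b *: (x - r * a : R^o) + (y - s * a).
  by rewrite scalerBr mulrDl opprD addrACA /GRing.scale /= mulrA.
by rewrite idealD ?idealM.
Qed.

Hypothesis noethR : noetherian R.

Lemma noetherian_ring_module : @noetherian_module R R^o.
Proof. by move=> J; apply/fin_gen_submod; apply: noethR. Qed.

(** An annihilator maximal among those of nonzero multiples of [v] is prime: if a b kills c v and b
    does not, then the annihilator of b c v is no larger, and it contains a. *)
Lemma associated_prime (V : lmodType R) (v : V) : v != 0 ->
  exists c, c *: v != 0 /\ prime_ideal (annihilator (c *: v)).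
Proof.
move=> v0.
have [|J [c [cv0 Jc]] Jmax] := noetherian_max
  (F := fun J : ideal R => exists c, c *: v != 0 /\ J = annihilator (c *: v))
  noetherian_ring_module.
  by exists (annihilator (1 *: v)), 1; rewrite scale1r.
move: Jmax; rewrite {}Jc => Jmax; exists c; split=> //; split.
  by apply/negP => /annihilatorP; rewrite scale1r; apply/eqP.
move=> a b; move/annihilatorP => ab.
have [bc0|bc0] := eqVneq (b *: (c *: v)) 0.
  by apply/orP; right; apply/annihilatorP.
apply/orP; left; apply: (Jmax (annihilator ((b * c) *: v))).
- by exists (b * c); rewrite -scalerA.
- by move=> r /annihilatorP rc; apply/annihilatorP;
    rewrite scalerA mulrCA -scalerA -[(r * c) *: v]scalerA rc scaler0.
- by apply/annihilatorP; rewrite scalerA mulrA -scalerA.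
Qed.

Variable m : ideal R.
Hypothesis localR : local_ring m.

Lemma proper_ideal_sub J : 1 \notin J -> {subset J <= m}.
Proof.
move=> J1.
have [|S [S1 JS] Smax] := noetherian_max
  (F := fun S : ideal R => 1 \notin S /\ {subset J <= S}) noetherian_ring_module.
  by exists J; split=> // x.
have Sm : S =i m.
  apply: localR.2; split=> // T T1 ST x; apply/idP/idP => [|/ST //].
  by apply: Smax => //; split=> // y /JS /ST.
by move=> x /JS; rewrite Sm.
Qed.

Lemma one_sub_unit (a : R) : a \in m -> exists u, u * (1 - a) = 1.
Proof.
move=> am.
have [||J JP] := @prop_submod_ex R R^o (fun x : R => exists u, u * (1 - a) = x).
- by exists 0; rewrite mul0r.
- move=> b _ _ [u <-] [u' <-]; exists (b * u + u').
  by rewrite mulrDl /GRing.scale /= mulrA.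
have [/JP //|J1] := boolP ((1 : R) \in J).
have : (1 : R) \in m.
  have -> : (1 : R) = (1 - a) + a by rewrite subrK.
  apply: idealD => //; apply: (proper_ideal_sub J1).
  by apply/JP; exists 1; rewrite mul1r.
by rewrite (negPf localR.1.1).
Qed.

Lemma prime_maximal : prime_ideal m.
Proof.
split; first exact: localR.1.1.
move=> u v uv; apply/orP; have [|um] := boolP (u \in m); [by left|right].
have [J JP] := ideal_sum_ex m u.
have [/JP [a am]|J1] := boolP ((1 : R) \in J).
  have -> : v = v * (1 - a * u) + a * (u * v).
    by ring.
  by apply: idealD; apply: idealM.
have /negP [] := um; rewrite -(localR.1.2 J J1).
  by apply/JP; exists 1; rewrite mul1r subrr ideal0.
by move=> x xm; apply/JP; exists 0; rewrite mul0r subr0.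
Qed.

Hypothesis dimR : krull_dim R 1.

(** Otherwise q < p < m would be a chain of length two. *)
Lemma prime_minimal p q : prime_ideal p -> ~ p =i m -> prime_ideal q ->
  {subset q <= p} -> q =i p.
Proof.
move=> pp pm qp qsub; apply: contrapT => qNp.
suff /dimR.2 : prime_chain R 2 by [].
exists (fun n => if n is n.+1 then if n is n'.+1 then m else p else q).
split=> [[|[|n]] _ //|[|[|n]] //= _]; first exact: prime_maximal.
by split=> //; apply: proper_ideal_sub; case: pp.
Qed.

(* An ideal maximal among those avoiding the multiplicative set of all s f^n
   with s outside p would be a prime strictly below p. *)
Lemma minimal_prime_nilpotent p (f : R) : prime_ideal p -> ~ p =i m -> f \in p ->
  exists s n, s \notin p /\ s * f ^+ n = 0.
Proof.
move=> pp pm fp; apply: contrapT => H.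
pose W x := exists s n, s \notin p /\ s * f ^+ n = x.
have [|J JW Jmax] := noetherian_max
  (F := fun J : ideal R => forall x, x \in J -> ~ W x) noetherian_ring_module.
  have [||Z ZP] := @prop_submod_ex R R^o (fun x => x = 0) => //.
    by move=> a _ _ -> ->; rewrite scaler0 addr0.
  exists Z => x /ZP -> [s [n [sp sf]]]; apply: H; by exists s, n.
have Jadd a : a \notin J -> exists r x, x + r * a \in J /\ W x.
  move=> aJ; apply: contrapT => nW; have [K KP] := ideal_sum_ex J a.
  have : {subset K <= J}.
    apply: Jmax => [x /KP [r xr] Wx|x xJ].
      by apply: nW; exists (- r), x; rewrite mulNr.
    by apply/KP; exists 0; rewrite mul0r subr0.
  move/(_ a) => KJ; case/negP: aJ; apply: KJ; apply/KP.
  by exists 1; rewrite mul1r subrr ideal0.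
have Jp : prime_ideal J.
  split.
    apply/negP => /JW; apply; exists 1, 0%N.
    by rewrite mulr1 pp.1.
  move=> a b abJ; apply: contrapT => /negP; rewrite negb_or => /andP [aJ bJ].
  have [r [x [xJ [s [n [sp sx]]]]]] := Jadd a aJ.
  have [r' [x' [xJ' [s' [n' [sp' sx']]]]]] := Jadd b bJ.
  apply: (JW (x * x')).
    have -> : x * x' = x' * (x + r * a) + - (r * a) * (x' + r' * b)
        + (r * r') * (a * b) by ring.
    by do ?[apply: idealD]; apply: idealM.
  exists (s * s'), (n + n')%N; split.
    by apply/negP => /(prime_idealM pp) []; apply/negP.
  by rewrite exprD mulrACA sx sx'.
have Jsub : {subset J <= p}.
  move=> x xJ; apply: contrapT => /negP xp; apply: (JW x xJ).
  by exists x, 0%N; rewrite mulr1.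
(* As [p] is minimal, [J] equals [p] and contains [f]; but [f] itself lies in the multiplicative
   set. *)
have fJ : f \in J by rewrite (prime_minimal pp pm Jp Jsub).
apply: (JW f fJ); exists 1, 1%N; by rewrite mul1r pp.1.
Qed.

(** An element of a minimal prime has a power killed by some s outside the prime; for a regular
    element this forces s = 0. *)
Lemma prime_with_regular p (r : R) : prime_ideal p -> r \in p -> GRing.lreg r -> p =i m.
Proof.
move=> pp rp rreg; apply: contrapT => pm.
have [s [n [sp sr]]] := minimal_prime_nilpotent pp pm rp.
case/negP: sp; suff -> : s = 0 by rewrite ideal0.
by apply: (@lreg0 (r ^+ n)); [exact: lregX | rewrite mulrC].
Qed.

(** Choosing s outside p with maximal annihilator imitates localization: multiplying s by elements
    outside p no longer enlarges the annihilator. So every element of p has a power killing s, and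
    an associated prime of R s contains p. It is not m, since x is regular, hence it equals p. *)
Lemma minimal_prime_annihilator p (x : R) : prime_ideal p -> ~ p =i m ->
  x \in m -> GRing.lreg x -> exists y : R^o, annihilator y =i p.
Proof.
move=> pp pm xm xreg.
have [|J [s [sp Js]] Jmax] := noetherian_max
  (F := fun J : ideal R => exists s : R^o, s \notin p /\ J = annihilator s)
  noetherian_ring_module.
  by exists (annihilator (1 : R^o)), 1; rewrite pp.1.
move: Jmax; rewrite {}Js => Jmax.
have s0 : s != 0 by apply: contraNneq sp => ->; rewrite ideal0.
have [c [cs0 cprime]] := associated_prime s0; exists (c *: s).
have psub : {subset p <= annihilator (c *: s)}.
  move=> f fp; have [t [n [tp tf]]] := minimal_prime_nilpotent pp pm fp.
  apply: (@prime_ideal_exp _ _ n cprime).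
  suff /annihilatorP fs : f ^+ n \in annihilator s.
    by apply/annihilatorP; rewrite scalerA mulrC -scalerA fs scaler0.
  apply: (Jmax (annihilator (t * s : R^o))).
  - exists (t * s); split=> //.
    by apply/negP => /(prime_idealM pp) []; apply/negP.
  - move=> r /annihilatorP rs; apply/annihilatorP.
    rewrite /GRing.scale /= in rs *; by rewrite mulrCA rs mulr0.
  - apply/annihilatorP; rewrite /GRing.scale /= mulrA [_ * t]mulrC tf.
    by rewrite mul0r.
have qm : ~ annihilator (c *: s) =i m.
  move=> qm; have : x \in annihilator (c *: s) by rewrite qm.
  by move=> /annihilatorP /(lreg0 xreg) /eqP; rewrite (negPf cs0).
by move=> r; rewrite (prime_minimal cprime qm pp psub).
Qed.

End PrimeIdeals.

(** * Torsion and devissage *)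

Section DimensionOne.
Variables (R : comNzRingType) (m : ideal R).
Hypotheses (noethR : noetherian R) (localR : local_ring m).
Hypothesis dimR : krull_dim R 1.

Definition torsionfree (V : lmodType R) : Prop :=
  forall (r : R) (v : V), GRing.lreg r -> r *: v = 0 -> v = 0.

Definition torsion_module (V : lmodType R) : Prop :=
  forall v : V, exists r : R, GRing.lreg r /\ r *: v = 0.

Lemma associated_prime_regular (V : lmodType R) (v : V) (r : R) :
  v != 0 -> GRing.lreg r -> r *: v = 0 ->
  exists2 c, c *: v != 0 & annihilator (c *: v) =i m.
Proof.
move=> v0 rreg rv; have [c [cv0 cp]] := associated_prime noethR v0.
exists c => //; apply: (prime_with_regular noethR localR dimR cp _ rreg).
by apply/annihilatorP; rewrite scalerA mulrC -scalerA rv scaler0.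
Qed.

(** A nonzero element killed by a regular element has a nonzero multiple killed by m, hence by
    [x]. *)
Lemma regular_torsionfree (V : lmodType R) (x : R) :
  x \in m -> injective (@homothety R V x) -> torsionfree V.
Proof.
move=> xm xV r v rreg rv; apply/eqP; apply: contraT => v0.
have [c /eqP cv0 cm] := associated_prime_regular v0 rreg rv.
case: cv0; apply: xV; rewrite /homothety scaler0.
by apply/annihilatorP; rewrite cm.
Qed.

Lemma maximal_cm_regular (V : lmodType R) : maximal_cohen_macaulay m V ->
  exists2 x : R, x \in m & injective (@homothety R V x).
Proof.
move=> [_ [d [dimd [[s [sz sm sV]] _]]]].
have d1 : d = 1%N.
  apply/eqP; rewrite eqn_leq (dimR.2 _ dimd.1) (dimd.2 _ dimR.1) //.
case: s sz sm sV => [|x s]; first by rewrite d1.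
by move=> _ xm [? _]; exists x => //; apply: xm; rewrite mem_head.
Qed.

Lemma cm_ring_regular : cohen_macaulay_ring m ->
  exists2 x : R, x \in m & GRing.lreg x.
Proof. by move=> /maximal_cm_regular [x xm xR]; exists x. Qed.

(** A maximal submodule S satisfying P must be V: otherwise V/S, being torsion, contains an element
    with annihilator m, and adjoining it to S is an extension by R/m. Invariance under isomorphism
    passes from the submodule type to V. *)
Lemma devissage (P : lmodType R -> Prop) :
  (forall A : lmodType R, (forall a : A, a = 0) -> P A) ->
  (forall (A B : lmodType R) (f : {linear A -> B}), bijective f -> P A -> P B) ->
  (forall (A B : lmodType R) (f : {linear A -> B})
      (g : {linear B -> residue_field m}), short_exact f g -> P A -> P B) ->
  forall V : lmodType R, fin_gen V -> torsion_module V -> P V.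
Proof.
move=> P0 Piso Pext V Vfg Vtor.
have [|S PS Smax] := noetherian_max
  (F := fun S : submodClosed V => P (submod S)) (fin_gen_noetherian noethR Vfg).
  have [||Z ZP] := @prop_submod_ex R V (fun x => x = 0) => //.
    by move=> a _ _ -> ->; rewrite scaler0 addr0.
  exists Z; apply: P0 => -[x xZ]; apply: val_inj => /=.
  by rewrite ((ZP x).1 xZ); exact: esym (linear0 (@submod_val _ _ Z)).
have [SV|] := pselect (forall v, v \in S).
  apply: (Piso _ _ (@submod_val _ _ S)) PS.
  exists (fun v => Submod (SV v)); last by [].
  by move=> x; apply: val_inj.
move=> /existsNP [v /negP vS].
have v0 : qproj S v != 0.
  rewrite -(linear0 (qproj S)); apply: contraNneq vS => /qproj_eq.
  by rewrite subr0.
have [r [rreg rv]] := Vtor v.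
have [|c cv0 cm] := associated_prime_regular v0 rreg.
  by rewrite -linearZ rv linear0.
pose u := c *: v.
have uS a : a *: u \in S <-> a \in m.
  have -> : a \in m <-> qproj S (a *: u) = 0.
    by rewrite -cm annihilatorP /u !qproj_scalable.
  by rewrite -(linear0 (qproj S)) qproj_eq subr0.
clearbody u.
have [||T TP] := @prop_submod_ex R V (fun x => exists a, x - a *: u \in S).
- by exists 0; rewrite scale0r subr0 rpred0.
- move=> b x y [a xa] [a' ya]; exists (b * a + a').
  have -> : b *: x + y - (b * a + a') *: u = b *: (x - a *: u) + (y - a' *: u).
    by rewrite scalerDl scalerBr scalerA opprD addrACA.
  by rewrite rpredD ?rpredZ.
have ST : {subset S <= T}.
  by move=> x xS; apply/TP; exists 0; rewrite scale0r subr0.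
have [|f fE] := factor_inj (h := @submod_val _ _ S) (val_inj : injective (@submod_val _ _ T)).
  by move=> x; exists (Submod (ST _ (submod_valP x))).
(* The coefficient of [u] is determined modulo [m] by [uS]. *)
have [|||g gE] := @linear_of_rel R (submod T) (residue_field m)
  (fun x q => exists2 a : R, submod_val x - a *: u \in S & q = qproj m a).
- by move=> [x xT]; have /TP [a xa] := xT; exists (qproj m a), a.
- move=> b x x' y y' [a xa ->] [a' xa' ->]; exists (b * a + a').
    have -> : submod_val (b *: x + x') - (b * a + a') *: u =
        b *: (submod_val x - a *: u) + (submod_val x' - a' *: u).
      by rewrite submod_val_linear scalerDl scalerBr scalerA opprD addrACA.
    by rewrite rpredD ?rpredZ.
  by rewrite (linearP (qproj m) b (a : R^o)).
- move=> y [a]; rewrite linear0 sub0r => /submodN; rewrite opprK => /uS am ->.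
  by rewrite -(linear0 (qproj m)); apply/qproj_eq; rewrite subr0.
have /(_ u) : {subset T <= S}.
  apply: Smax ST; apply: (Pext _ _ f g) PS; split.
  - by move=> x y /(congr1 (@submod_val _ _ _)); rewrite !fE => /val_inj.
  - move=> y; split=> [gy0|[x <-]]; last first.
      apply: etrans (gE _ 0 _) _ => //; exists 0.
        by rewrite scale0r subr0 fE submod_valP.
      by rewrite linear0.
    have /TP [a ya] := submod_valP y.
    have am : a \in m.
      have : qproj m a = qproj m 0 by rewrite linear0 -gy0; apply/esym/gE; exists a.
      by move=> /qproj_eq; rewrite subr0.
    have yS : submod_val y \in S.
      by rewrite -[submod_val y](subrK (a *: u)) rpredD //; apply/uS.
    by exists (Submod yS); apply: val_inj; rewrite /= fE.
  - move=> q; have [a <-] := qproj_surj q.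
    have auT : a *: u \in T by apply/TP; exists a; rewrite subrr rpred0.
    by exists (Submod auT); apply: gE; exists a; rewrite //= subrr rpred0.
have uT : u \in T by apply/TP; exists 1; rewrite scale1r subrr rpred0.
move=> /(_ uT); rewrite -[u]scale1r => /uS.
by rewrite (negPf localR.1.1).
Qed.

End DimensionOne.

(** * Presentations of modules of projective dimension at most one *)

Section Projective.
Variable R : comNzRingType.

Lemma exact_comp0 (U V W : lmodType R) (f : U -> V) (g : V -> W) x :
  exact_at f g -> g (f x) = 0.
Proof. by move=> fg; apply/fg; exists x. Qed.

Lemma kernel_exact (U V : lmodType R) (g : {linear U -> V}) :
  Defs.surjective g -> short_exact (@submod_val _ _ (linker g)) g.
Proof.
move=> gs; split=> //; first exact: val_inj.
move=> y; split=> [gy|[x <-]]; last by have := submod_valP x; rewrite inE => /eqP.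
have yK : y \in linker g by rewrite inE gy.
by exists (Submod yK).
Qed.

(** The finitely generated projective modules, in coordinates, because coordinate formulas pass to
    tensor products. *)
Definition dual_basis (P : lmodType R) : Prop :=
  exists n (b : 'I_n -> P) (f : 'I_n -> {linear P -> R^o}),
    forall x, x = \sum_(i < n) f i x *: b i.

Lemma ffun_linear_ex (V : lmodType R) n (v : 'I_n -> V) :
  exists p : {linear {ffun 'I_n -> R^o} -> V},
    forall c, p c = \sum_(i < n) c i *: v i.
Proof.
apply: linear_ex => a x y; rewrite scaler_sumr -big_split.
by apply: eq_bigr => i _ /=; rewrite !ffunE scalerDl scalerA.
Qed.

Lemma dual_basis_free n : dual_basis {ffun 'I_n -> R^o}.
Proof.
have coord i : exists f : {linear {ffun 'I_n -> R^o} -> R^o}, forall x, f x = x i.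
  by apply: (@linear_ex R {ffun 'I_n -> R^o} R^o (fun x => x i)) => a x y;
    rewrite !ffunE.
have [f fE] := choice coord.
exists n, (fun i => [ffun j => (j == i)%:R]), f => x; apply/ffunP => j.
rewrite sum_ffunE (bigD1 j) //= !ffunE fE eqxx /GRing.scale /= mulr1.
rewrite big1 ?addr0 // => i ij; rewrite !ffunE eq_sym (negPf ij).
exact: mulr0.
Qed.

Lemma free_cover (V : lmodType R) : fin_gen V ->
  exists n (p : {linear {ffun 'I_n -> R^o} -> V}), Defs.surjective p.
Proof.
move=> [n [v vE]]; have [p pE] := ffun_linear_ex v; exists n, p => x.
have [c ->] := vE x; exists [ffun i => c i]; rewrite pE.
by apply: eq_bigr => i _; rewrite ffunE.
Qed.

Lemma dual_basis_fin_gen (P : lmodType R) : dual_basis P -> fin_gen P.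
Proof. by move=> [n [b [f fE]]]; exists n, b => x; exists (fun i => f i x). Qed.

(** The condition on [g] is pointwise on the values of [f], so it can be read off directly from
    exactness. *)
Lemma dual_basis_lift (P U W : lmodType R) (f : {linear P -> W})
    (g : {linear U -> W}) : dual_basis P -> (forall x, exists u, g u = f x) ->
  exists h : {linear P -> U}, forall x, g (h x) = f x.
Proof.
move=> [n [b [e eE]]] gf; have [u uE] := choice (fun i => gf (b i)).
have [|h hE] := @linear_ex R P U (fun x => \sum_(i < n) e i x *: u i).
  move=> a x y; rewrite scaler_sumr -big_split; apply: eq_bigr => i _ /=.
  by rewrite linearP scalerDl scalerA.
exists h => x; rewrite hE {2}[x]eE !linear_sum; apply: eq_bigr => i _.
by rewrite !linearZ_LR uE.
Qed.

Lemma projective_dual_basis (P : lmodType R) :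
  fin_gen P -> projective P -> dual_basis P.
Proof.
move=> Pfg Pproj; have [n [p ps]] := free_cover Pfg.
have [s sE] := Pproj _ _ p idfun ps.
have [l [b [f fE]]] := dual_basis_free n.
exists l, (fun i => p (b i)), (fun i => f i \o s) => x.
rewrite -{1}[x]sE [s x]fE linear_sum; apply: eq_bigr => i _.
by rewrite linearZ_LR.
Qed.

(* Schanuel: the kernel K of F -> M is a retract of P1 + F. *)
Lemma projdim1_presentation (M : lmodType R) :
  noetherian R -> fin_gen M -> projdim_le M 1 ->
  exists (K F : lmodType R) (k : {linear K -> F}) (p : {linear F -> M}),
    [/\ dual_basis K, dual_basis F & short_exact k p].
Proof.
move=> noethR Mfg [P [d [eps [[Pp epss d0 dn] Pv]]]].
have [n [p ps]] := free_cover Mfg.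
pose F : lmodType R := {ffun 'I_n -> R^o}; pose K : lmodType R := submod (linker p).
have Fdb : dual_basis F by apply: dual_basis_free.
have kex := kernel_exact ps.
exists K, F, (@submod_val _ _ (linker p)), p; split=> //.
pose k : {linear K -> F} := @submod_val _ _ (linker p).
have kI : injective k by case: kex.
(* The kernel of [d 0] is the image of [P 2], which is zero. *)
have d0I : injective (d 0).
  apply: linear_inj => x dx; have [y <-] := (dn 0 x).1 dx.
  by rewrite (Pv 2 _ y) ?linear0.
have [u uE] := dual_basis_lift (f := p) (g := eps) Fdb (fun x => epss (p x)).
have [v vE] := Pp 0%N _ _ p eps ps.
(* With [u] and [v] comparing F and P 0 over M, the maps [a], [b] are induced on kernels and [c] is
   1 - v u with values in K. Then b a + c k is the identity of K, the announced retraction. *)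
have [|a aE] := factor_inj (h := u \o k) d0I.
  by move=> x; apply/d0; rewrite /= uE (exact_comp0 x (f := k)) //; case: kex.
have [|b bE] := factor_inj (h := v \o d 0) kI.
  move=> x; have [_ kp _] := kex; apply/kp.
  by rewrite /= vE (exact_comp0 x (f := d 0)).
have [c0 c0E] : exists c : {linear F -> F}, forall x, c x = x - v (u x).
  by apply: linear_ex => r x y; rewrite (linearP u) (linearP v) opprD scalerBr addrACA.
have [|c cE] := factor_inj (h := c0) kI.
  move=> x; have [_ kp _] := kex; apply/kp.
  by rewrite c0E linearB vE uE subrr.
apply: projective_dual_basis.
  by apply: fin_gen_sub kI _ => //; apply: dual_basis_fin_gen.
move=> U V g f gs.
have [h1 h1E] := Pp 1%N _ _ g (f \o b) gs.
have [h2 h2E] := dual_basis_lift (f := f \o c) (g := g) Fdb (fun x => gs (f (c x))).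
have [h hE] : exists h : {linear K -> U}, forall x, h x = h1 (a x) + h2 (k x).
  by apply: linear_ex => r x y; rewrite (linearP a) (linearP h1) (linearP k) (linearP h2) scalerDr addrACA.
exists h => x; rewrite hE linearD h1E h2E /= -linearD; congr (f _).
by apply: kI; rewrite linearD bE cE /= aE c0E /= addrC subrK.
Qed.

End Projective.

(** * Exactness of the tensor product with omega *)

Section Tensor.
Variable R : comNzRingType.
Implicit Types M N : lmodType R.

Lemma tensor_ind M N (S : submodClosed (tensor M N)) :
  (forall x y, tens x y \in S) -> forall t, t \in S.
Proof.
move=> ST t.
suff : qproj S t = qproj S 0 by move=> /qproj_eq; rewrite subr0.
rewrite linear0; apply: (@tensor_ext R M N _ (qproj S) \0) => x y /=.
by rewrite -(linear0 (qproj S)); apply/qproj_eq; rewrite subr0.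
Qed.

Lemma tensor_lift_ex M N (L : lmodType R) (b : M -> N -> L) :
  (forall y, linear (b^~ y)) -> (forall x, linear (b x)) ->
  exists f : {linear tensor M N -> L}, forall x y, f (tens x y) = b x y.
Proof.
move=> bl br.
pose b' : {bilinear M -> N -> L} := HB.pack_for {bilinear M -> N -> L} b
  (bilinear_isBilinear.Build R M N L *:%R *:%R b (bl, br)).
by exists (tensor_lift b') => x y; exact: (tensor_lift_tens b').
Qed.

Lemma tens_suml M N n (c : 'I_n -> R) (b : 'I_n -> M) (y : N) :
  tens (\sum_(i < n) c i *: b i) y = \sum_(i < n) tens (b i) (c i *: y).
Proof.
rewrite linear_sumlz; apply: eq_bigr => i _.
by rewrite linearZl_LR linearZr_LR.
Qed.

Lemma tensor_map_comp M M' M'' N (f : {linear M -> M'}) (g : {linear M' -> M''})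
    (h : {linear M -> M''}) : (forall x, h x = g (f x)) ->
  forall t, tensor_map N h t = tensor_map N g (tensor_map N f t).
Proof.
move=> hE; apply: (@tensor_ext R M N _ (tensor_map N h)
  (tensor_map N g \o tensor_map N f)) => x y /=.
by rewrite !tensor_map_tens hE.
Qed.

Lemma tensor_map_surj M M' N (f : {linear M -> M'}) :
  Defs.surjective f -> Defs.surjective (tensor_map N f).
Proof.
move=> fs t; apply/asboolP; apply: (tensor_ind (S := linim (tensor_map N f))).
move=> x y; have [z <-] := fs x; apply/asboolP; exists (tens z y).
by rewrite tensor_map_tens.
Qed.

(** The class of [tens x y] modulo the image depends only on [g x]. A set-theoretic section of [g]
    therefore defines a linear map from M2 (x) N to the quotient, through which the projection
    factors. *)
Lemma tensor_right_exact M1 M M2 N (f : {linear M1 -> M}) (g : {linear M -> M2}) :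
  exact_at f g -> Defs.surjective g -> exact_at (tensor_map N f) (tensor_map N g).
Proof.
move=> fg gs t; split=> [gt|[u <-]]; last first.
  rewrite -(tensor_map_comp (h := \0)); last first.
    by move=> x /=; rewrite (exact_comp0 x fg).
  apply: (@tensor_ext R M1 N _ (tensor_map N \0) \0) => x y.
  by rewrite tensor_map_tens /= linear0l.
have [s sE] := choice gs.
pose S : submodClosed (tensor M N) := linim (tensor_map N f).
have q0 x x' y : g x = g x' -> qproj S (tens x y) = qproj S (tens x' y).
  move=> gx; apply/qproj_eq; rewrite -linearBl.
  have [z <-] : exists z, f z = x - x' by apply/fg; rewrite linearB gx subrr.
  by apply/asboolP; exists (tens z y); rewrite tensor_map_tens.
have [||h hE] := @tensor_lift_ex M2 N (quotmod S) (fun x y => qproj S (tens (s x) y)).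
- move=> y a x x'; rewrite -linearP -linearPl; apply: q0.
  by rewrite linearP !sE.
- by move=> x a y y'; rewrite -linearP -linearPr.
have hg : forall t, h (tensor_map N g t) = qproj S t.
  apply: (@tensor_ext R M N _ (h \o tensor_map N g) (qproj S)) => x y /=.
  by rewrite tensor_map_tens hE; apply: q0; rewrite sE.
have : qproj S t = qproj S 0 by rewrite -hg gt !linear0.
by move=> /qproj_eq; rewrite subr0 => /asboolP.
Qed.

Lemma tensor_eval_ex M N (f : {linear M -> R^o}) :
  exists e : {linear tensor M N -> N}, forall x y, e (tens x y) = (f x : R) *: y.
Proof.
apply: tensor_lift_ex => [y a x x'|x a y y'].
  by rewrite (linearP f) scalerDl scalerA.
by rewrite scalerDr !scalerA mulrC.
Qed.

Lemma tensor_dual_basis (P N : lmodType R) n (b : 'I_n -> P) (f : 'I_n -> {linear P -> R^o})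
    (e : 'I_n -> {linear tensor P N -> N}) :
  (forall x, x = \sum_(i < n) f i x *: b i) ->
  (forall i x y, e i (tens x y) = (f i x : R) *: y) ->
  forall t, t = \sum_(i < n) tens (b i) (e i t).
Proof.
move=> bf eE.
have [h hE] : exists h : {linear tensor P N -> tensor P N},
    forall t, h t = \sum_(i < n) tens (b i) (e i t).
  apply: linear_ex => a t t'; rewrite scaler_sumr -big_split.
  by apply: eq_bigr => i _; rewrite (linearP (e i)) linearPr.
move=> t; rewrite -hE; apply: (@tensor_ext R P N _ idfun h) => x y.
rewrite hE /= {1}[x]bf tens_suml; apply: eq_bigr => i _.
by rewrite eE.
Qed.

Lemma tensor_fin_gen M N : fin_gen M -> fin_gen N -> fin_gen (tensor M N).
Proof.
move=> /fin_genP [s sE] /fin_genP [r rE]; apply/fin_genP.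
exists [seq tens x y | x <- s, y <- r] => T stT; apply: tensor_ind => x y.
have [||S SP] := @prop_submod_ex R M (fun x => forall y, tens x y \in T).
- by move=> z; rewrite linear0l rpred0.
- by move=> a z z' zT zT' w; rewrite linearPl /=; apply: rpredD => //; apply: rpredZ.
suff /SP : x \in S by [].
apply: sE => z zs; apply/SP => w.
have [f fE] := linear_ex (tens_linearr (N := N) z).
have : w \in preimage f T.
  by apply: rE => v vr; rewrite inE fE; apply: stT; apply: allpairs_f.
by rewrite inE fE.
Qed.

End Tensor.

(** * Injectivity after tensoring with omega *)

Section TensorInjective.
Variables (R : comNzRingType) (m : ideal R).
Hypotheses (noethR : noetherian R) (localR : local_ring m).
Hypothesis dimR : krull_dim R 1.

(* S is maximal among the submodules meeting R z trivially; a multiple by some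
   r outside p sends N into S + R z, and R z is a copy of R y. *)
Lemma functional_nonzero (p : ideal R) (y : R) (N : lmodType R) (z : N) :
  prime_ideal p -> (forall a : R, a \in p <-> a * y = 0) -> fin_gen N ->
  (forall w : N, w != 0 -> forall a : R, a \in p <-> a *: w = 0) ->
  z != 0 -> exists f : {linear N -> R^o}, f z != 0.
Proof.
move=> pp yE Nfg NE z0.
have [|S Sz Smax] := noetherian_max
  (F := fun S : submodClosed N => forall a, a *: z \in S -> a *: z = 0)
  (fin_gen_noetherian noethR Nfg).
  have [||Z ZP] := @prop_submod_ex R N (fun x => x = 0) => //.
    by move=> a _ _ -> ->; rewrite scaler0 addr0.
  by exists Z => a /ZP.
(* For a fixed [r], the functional will send [w] to c y. *)
pose G (r : R) w (c : R) := r *: w - c *: z \in S.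
have local_mult w : exists2 r : R, r \notin p & exists c, G r w c.
  have [wS|wS] := boolP (w \in S).
    exists 1; first by case: pp.
    by exists 0; rewrite /G scale1r scale0r subr0.
  have [||T TP] := @prop_submod_ex R N (fun x => exists b, x - b *: w \in S).
  - by exists 0; rewrite scale0r subr0 rpred0.
  - move=> a x x' [b xb] [b' xb']; exists (a * b + b').
    have -> : a *: x + x' - (a * b + b') *: w =
        a *: (x - b *: w) + (x' - b' *: w).
      by rewrite scalerDl scalerBr scalerA opprD addrACA.
    by rewrite rpredD ?rpredZ.
  have ST : {subset S <= T}.
    by move=> x xS; apply/TP; exists 0; rewrite scale0r subr0.
  have [a [/TP [b azb] /eqP az0]] : exists a, a *: z \in T /\ a *: z <> 0.
    apply: contrapT => nT; case/negP: wS; apply: (Smax T) => //.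
      move=> a aT; apply: contrapT => az; apply: nT; by exists a.
    by apply/TP; exists 1; rewrite scale1r subrr rpred0.
  exists b; last by exists a; rewrite /G -opprB submodN.
  (* If [b] were in [p] it would kill [w], and the nonzero multiple of [z] would lie in [S]. *)
  apply: contra az0 => bp; apply/eqP; apply: Sz.
  suff bw : b *: w = 0 by rewrite bw subr0 in azb.
  by have [->|w0] := eqVneq w 0; [rewrite scaler0 | apply/(NE w w0)].
(* The product of the multipliers of finitely many generators serves all elements at once, and stays
   outside the prime [p]. *)
have [r rp rG] : exists2 r : R, r \notin p & forall w, exists c, G r w c.
  have [n [v vE]] := Nfg.
  have /choice [r rE] i : exists r : R, r \notin p /\ exists c, G r (v i) c.
    by have [r rp [c cG]] := local_mult (v i); exists r; split=> //; exists c.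
  exists (\prod_(i < n) r i).
    elim/big_ind: _ => [|a b ap bp|i _].
    - by case: pp.
    - by apply/negP => /(prime_idealM pp) []; apply/negP.
    - by have [] := rE i.
  move=> w; have [||T TP] := @prop_submod_ex R N
    (fun w => exists c, G (\prod_(i < n) r i) w c).
  - by exists 0; rewrite /G scaler0 scale0r subrr rpred0.
  - move=> a x x' [c xc] [c' xc']; exists (a * c + c'); rewrite /G.
    have -> : (\prod_(i < n) r i) *: (a *: x + x') - (a * c + c') *: z =
        a *: ((\prod_(i < n) r i) *: x - c *: z)
        + ((\prod_(i < n) r i) *: x' - c' *: z).
      rewrite scalerDl scalerBr scalerDr !scalerA opprD addrACA.
      by rewrite [a * \prod_(i < n) r i]mulrC.
    by rewrite rpredD ?rpredZ.
  apply/TP; have [c ->] := vE w; apply: rpred_sum => i _; apply: rpredZ.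
  apply/TP; have [_ [d dG]] := rE i; rewrite (bigD1 i) //= mulrC.
  exists (\prod_(j < n | j != i) r j * d).
  by rewrite /G -!scalerA -scalerBr rpredZ.
have [|||f fE] := @linear_of_rel R N R^o
  (fun w u => exists2 c, G r w c & u = c * y).
- by move=> w; have [c cG] := rG w; exists (c * y), c.
- move=> a x x' _ _ [c xc ->] [c' xc' ->]; exists (a * c + c').
    rewrite /G; have -> : r *: (a *: x + x') - (a * c + c') *: z =
        a *: (r *: x - c *: z) + (r *: x' - c' *: z).
      rewrite scalerDl scalerBr scalerDr !scalerA opprD addrACA.
      by rewrite [a * r]mulrC.
    by rewrite rpredD ?rpredZ.
  by rewrite mulrDl -mulrA.
- move=> u [c]; rewrite /G scaler0 sub0r -scaleNr => /Sz cz ->.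
  by apply/yE/(NE z z0); apply/eqP; rewrite -oppr_eq0 -scaleNr cz.
exists f; rewrite (fE z (r * y)).
  by apply: contra rp => /eqP ry; apply/yE.
by exists r; rewrite // /G subrr rpred0.
Qed.

(* A kernel element whose annihilator is a prime p has its coordinates in
   omega[p]; functionals omega[p] -> R carry it to the kernel of g itself. *)
Lemma tensor_map_injective (omega K F : lmodType R) (g : {linear K -> F}) (x : R) :
  x \in m -> GRing.lreg x -> fin_gen omega -> torsionfree omega ->
  dual_basis K -> dual_basis F -> injective g -> injective (tensor_map omega g).
Proof.
move=> xm xreg ofg otf [n [b [f bf]]] [l [b' [f' bf']]] gI.
have tfN (w : omega) : w != 0 -> ~ annihilator w =i m.
  move=> w0 wm; have : x \in annihilator w by rewrite wm.
  by move=> /annihilatorP /(otf _ _ xreg) /eqP; rewrite (negPf w0).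
apply: linear_inj => t gt; apply/eqP; apply: contraT => t0.
have [c [ct0 pp]] := associated_prime noethR t0.
have [e eE] := choice (fun i => tensor_eval_ex omega (f i)).
move: (c *: t) ct0 pp (linearZ_LR (tensor_map omega g) c t) => u u0 pp.
rewrite gt scaler0 => gu {t gt t0 c}.
pose p := annihilator u; rewrite -/p in pp.
pose w i := e i u.
have uE : u = \sum_(i < n) tens (b i) (w i) by exact: tensor_dual_basis bf eE _.
have [j wj0] : exists j, w j != 0.
  apply: contrapT => wN; case/eqP: u0; rewrite uE big1 // => i _.
  have -> : w i = 0 by apply/eqP; apply: contrapT => /negP wi; apply: wN; exists i.
  by rewrite linear0r.
have pw i a : a \in p -> a *: w i = 0.
  by move=> /annihilatorP au; rewrite -linearZ_LR au linear0.
(* An associated prime of R v contains p and differs from m, as omega is torsion-free; by minimality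
   it is p, so nothing outside p kills v. *)
have psub (v : omega) : v != 0 -> (forall a, a \in p -> a *: v = 0) ->
    ~ p =i m /\ forall a : R, a \in p <-> a *: v = 0.
  move=> v0 pv; have [c [cv0 qp]] := associated_prime noethR v0.
  have pq : {subset p <= annihilator (c *: v)}.
    by move=> a /pv av; apply/annihilatorP; rewrite scalerA mulrC -scalerA av scaler0.
  have qm := tfN _ cv0; have qE := prime_minimal noethR localR dimR qp qm pp pq.
  split=> [pm|a]; first by apply: qm => a; rewrite -qE pm.
  split=> [/pv //|av]; rewrite qE; apply/annihilatorP.
  by rewrite scalerA mulrC -scalerA av scaler0.
have [pm _] := psub _ wj0 (pw j).
have [y yp] := minimal_prime_annihilator noethR localR dimR pp pm xm xreg.
have [||N NP] := @prop_submod_ex R omega (fun v => forall a, a \in p -> a *: v = 0).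
- by move=> a _; rewrite scaler0.
- move=> a v v' vN vN' r rp; rewrite scalerDr vN' // addr0.
  by rewrite scalerA mulrC -scalerA vN // scaler0.
have wN i : w i \in N by apply/NP; exact: pw.
pose wn i : submod N := Submod (wN i).
have [|||||phi] := @functional_nonzero p y (submod N) (wn j) => //.
- by move=> a; rewrite -yp annihilatorP.
- exact: fin_gen_sub noethR _ _ _ (val_inj : injective (@submod_val _ _ N)) ofg.
- move=> v v0 a; have [|_ ->] := psub (submod_val v) _ ((NP _).1 (submod_valP v)).
    by apply: contra v0 => /eqP v0; apply/eqP; apply: val_inj.
  split=> [av|av]; first by apply: val_inj.
  by rewrite -linearZ_LR av linear0.
move=> /negP; case; apply/eqP.
have [e' e'E] := choice (fun i => tensor_eval_ex omega (f' i)).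
(* The image of [u] under [phi], applied to its coordinates: the vanishing of the coordinates of g
   (x) omega at [u] turns into g k = 0. *)
pose k := \sum_(i < n) (phi (wn i) : R) *: b i.
have k0 : k = 0.
  apply: gI; rewrite linear0 [g k]bf'; apply: big1 => i _.
  have -> : f' i (g k) = 0; last by rewrite scale0r.
  have : \sum_(q < n) (f' i (g (b q)) : R) *: w q = 0.
    apply: etrans (_ : e' i (tensor_map omega g u) = 0); last by rewrite gu linear0.
    rewrite uE !linear_sum; apply: eq_bigr => q _.
    by rewrite tensor_map_tens e'E.
  move=> sw; have {sw} swn : \sum_(q < n) (f' i (g (b q)) : R) *: wn q = 0.
    apply: val_inj; apply: etrans sw; apply: etrans (linear_sum _ _ _ _) _.
    by apply: eq_bigr => q _; exact: linearZ_LR.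
  rewrite -(linear0 phi) -swn !linear_sum; apply: eq_bigr => q _.
  by rewrite !linearZ_LR /GRing.scale /= mulrC.
(* The coordinates of [u] are fixed by the idempotent matrix of the f j (b i), so [phi] of the j-th
   one is f j k. *)
have -> : wn j = \sum_(i < n) (f j (b i) : R) *: wn i.
  apply: val_inj; rewrite linear_sum /= {1}/w {1}uE linear_sum.
  by apply: eq_bigr => i _; rewrite eE.
apply: etrans (_ : f j k = 0); last by rewrite k0 linear0.
rewrite /k !linear_sum; apply: eq_bigr => i _.
by rewrite !linearZ_LR /GRing.scale /= mulrC.
Qed.

End TensorInjective.

(* The pullback of M -> M2 <- F turns exactness at the left into right exactness
   of K (x) omega -> (M1 * F) (x) omega -> M (x) omega. *)
Lemma tensor_short_exact (R : comNzRingType) (omega K F M1 M M2 : lmodType R)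
    (k : {linear K -> F}) (q : {linear F -> M2})
    (i : {linear M1 -> M}) (p : {linear M -> M2}) :
  dual_basis F -> short_exact k q -> injective (tensor_map omega k) ->
  short_exact i p -> short_exact (tensor_map omega i) (tensor_map omega p).
Proof.
move=> Fdb [kI kq qs] kt [iI ip ps]; split; last first.
- exact: tensor_map_surj.
- exact: tensor_right_exact.
have [g gE] := dual_basis_lift (f := q) (g := p) Fdb (fun x => ps (q x)).
have [|h hE] := factor_inj (h := g \o k) iI.
  by move=> x; apply/ip; rewrite /= gE (exact_comp0 x kq).
(* M is the quotient of M1 * F by this copy of K; the sign makes i x + g y vanish on it. *)
have [a aE] : exists a : {linear K -> (M1 * F)%type}, forall x, a x = (- h x, k x).
  apply: linear_ex => r x y.
  by rewrite (linearP h) (linearP k) opprD -scalerN.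
have [s sE] : exists s : {linear (M1 * F)%type -> M}, forall x, s x = i x.1 + g x.2.
  by apply: linear_ex => r x y; rewrite (linearP i) (linearP g) scalerDr addrACA.
have as_ex : exact_at a s.
  move=> [x y]; rewrite sE /=; split=> [xy|[z]]; last first.
    by rewrite aE => -[<- <-]; rewrite linearN hE addNr.
  have [z zy] : exists z, k z = y.
    by apply/kq; rewrite -gE -[g y](addKr (i x)) xy addr0 linearN
      (exact_comp0 x ip) oppr0.
  exists z; rewrite aE zy; congr (_, _); apply: iI.
  by rewrite linearN hE /= zy; apply/eqP; rewrite eq_sym -addr_eq0 xy.
have ss : Defs.surjective s.
  move=> z; have [y yz] := qs (p z); have [x xz] : exists x, i x = z - g y.
    by apply/ip; rewrite linearB gE yz subrr.
  by exists (x, y); rewrite sE /= xz subrK.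
have [inl inlE] : exists f : {linear M1 -> (M1 * F)%type}, forall x, f x = (x, 0).
  by apply: linear_ex => r x y; congr (_, _); rewrite /= scaler0 addr0.
have [f1 f1E] : exists f : {linear (M1 * F)%type -> M1}, forall x, f x = x.1.
  exact: linear_ex.
have [f2 f2E] : exists f : {linear (M1 * F)%type -> F}, forall x, f x = x.2.
  exact: linear_ex.
apply: linear_inj => t it.
have := tensor_right_exact (N := omega) as_ex ss (tensor_map omega inl t).
rewrite -(tensor_map_comp (h := i)); last by move=> x; rewrite sE inlE linear0 addr0.
move=> [/(_ it) [u ut] _].
(* The F-component of [u] is its image under k (x) omega, and that of an element coming from M1 is
   zero. *)
have u0 : u = 0.
  apply: kt; rewrite linear0 (tensor_map_comp (f := a) (g := f2)); last first.
    by move=> x; rewrite f2E aE.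
  rewrite ut -(tensor_map_comp (h := \0)); last by move=> x; rewrite f2E inlE.
  apply: (@tensor_ext R M1 omega _ (tensor_map omega \0) \0) => x y.
  by rewrite tensor_map_tens /= linear0l.
have : tensor_map omega f1 (tensor_map omega inl t) = t.
  rewrite -(tensor_map_comp (h := idfun)); last by move=> x; rewrite f1E inlE.
  apply: (@tensor_ext R M1 omega _ (tensor_map omega idfun) idfun) => x y.
  by rewrite tensor_map_tens.
by rewrite -ut u0 !linear0.
Qed.

(** * Ext into a module with a finite injective resolution *)

Section InjectiveResolution.
Variables (R : comNzRingType) (omega : lmodType R) (I : nat -> lmodType R).
Variables (d : forall n, {linear I n -> I n.+1}) (eta : {linear omega -> I 0}).
Hypothesis resI : injective_resolution d eta.

Let Iinj n : injective_module (I n). Proof. by case: resI. Qed.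
Let etaI : injective eta. Proof. by case: resI. Qed.
Let d0 : exact_at eta (d 0). Proof. by case: resI. Qed.
Let dS n : exact_at (d n) (d n.+1). Proof. by case: resI. Qed.

(* Ext^(j+1)(C, omega) = 0 *)
Definition ext_zero (j : nat) (C : lmodType R) : Prop :=
  forall h : {linear C -> I j.+1}, (forall x, d j.+1 (h x) = 0) ->
  exists h' : {linear C -> I j}, forall x, d j (h' x) = h x.

Lemma ext_zero_trivial j (C : lmodType R) : (forall c : C, c = 0) -> ext_zero j C.
Proof. by move=> C0 h _; exists \0 => x; rewrite [x]C0 !linear0. Qed.

Lemma ext_zero_iso j (A B : lmodType R) (f : {linear A -> B}) :
  bijective f -> ext_zero j A -> ext_zero j B.
Proof.
move=> [f' fK f'K] Az h hc.
have [f1 f1E] : exists f1 : {linear B -> A}, f1 =1 f'.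
  apply: linear_ex => a x y; apply: (can_inj fK).
  by rewrite linearP !f'K.
have [|k kE] := Az (h \o f); first by move=> x; apply: hc.
by exists (k \o f1) => x; rewrite /= kE /= f1E f'K.
Qed.

Lemma ext_zero_top n : (forall i, (n < i)%N -> forall x : I i, x = 0) ->
  forall j C, (n <= j)%N -> ext_zero j C.
Proof.
move=> I0 j C nj h _; exists \0 => x /=.
by rewrite linear0 [h x]I0.
Qed.

(** By exactness a cocycle takes its values in the image of [d j], so it lifts. *)
Lemma ext_zero_dual_basis j (P : lmodType R) : dual_basis P -> ext_zero j P.
Proof.
by move=> Pdb h hc; apply: dual_basis_lift => // x; apply/dS.
Qed.

Section LongExact.
Variables (A B C : lmodType R) (f : {linear A -> B}) (g : {linear B -> C}).
Hypothesis fg : short_exact f g.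

(** A cocycle on B becomes zero on A after subtracting the coboundary of an extension to B of its
    primitive on A; the rest is a cocycle on C. *)
Lemma ext_zero_mid j : ext_zero j A -> ext_zero j C -> ext_zero j B.
Proof.
have [fI fgE gs] := fg; move=> Az Cz h hc.
have [|k kE] := Az (h \o f); first by move=> x; apply: hc.
have [k' k'E] := Iinj k fI.
have [h1 h1E] := linear_sub_ex h (d j \o k').
have [|h2 h2E] := factor_surj (h := h1) gs.
  by move=> _ /fgE [x <-]; rewrite h1E /= k'E kE subrr.
have [|l lE] := Cz h2.
  move=> y; have [x <-] := gs y; rewrite h2E h1E linearB hc /=.
  by rewrite (exact_comp0 _ (@dS j)) subrr.
have [t tE] : exists t : {linear B -> I j}, forall x, t x = k' x + l (g x).
  by apply: linear_ex => a x y; rewrite (linearP k') (linearP g) (linearP l)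
    scalerDr addrACA.
by exists t => x; rewrite tE linearD lE h2E h1E /= addrC subrK.
Qed.

(** The map [e] is the connecting homomorphism: an extension of the cocycle to B fails to be a
    cocycle by a cocycle on C one degree higher. *)
Lemma ext_zero_left j : ext_zero j B -> ext_zero j.+1 C -> ext_zero j A.
Proof.
have [fI fgE gs] := fg; move=> Bz Cz h hc.
have [l lE] := Iinj h fI.
have [|e eE] := factor_surj (h := d j.+1 \o l) gs.
  by move=> _ /fgE [x <-] /=; rewrite lE hc.
have [|e' e'E] := Cz e.
  by move=> y; have [x <-] := gs y; rewrite eE (exact_comp0 _ (@dS j.+1)).
have [h1 h1E] := linear_sub_ex l (e' \o g).
have [|k kE] := Bz h1.
  by move=> x; rewrite h1E linearB /= e'E eE subrr.
exists (k \o f) => x.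
by rewrite /= kE h1E lE /= (exact_comp0 _ fgE) linear0 subr0.
Qed.

(** A primitive on B restricts to a cocycle on A; correcting it by a coboundary makes it vanish on
    A, hence descend to C. *)
Lemma ext_zero_right j : ext_zero j A -> ext_zero j.+1 B -> ext_zero j.+1 C.
Proof.
have [fI fgE gs] := fg; move=> Az Bz h hc.
have [|k kE] := Bz (h \o g); first by move=> x; apply: hc.
have [|k' k'E] := Az (k \o f).
  by move=> x; rewrite /= kE /= (exact_comp0 _ fgE) linear0.
have [k2 k2E] := Iinj k' fI.
have [h1 h1E] := linear_sub_ex k (d j \o k2).
have [|h2 h2E] := factor_surj (h := h1) gs.
  by move=> _ /fgE [x <-]; rewrite h1E /= k2E k'E subrr.
exists h2 => y; have [x <-] := gs y.
by rewrite h2E h1E linearB kE /= (exact_comp0 _ (@dS j)) subr0.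
Qed.

End LongExact.

(* Multiplication by x is onto Ext^(j+1)(C, omega). *)
Lemma ext_divisible j (C : lmodType R) (x : R) :
  injective (@homothety R C x) ->
  ext_zero j.+1 (quotmod (linim (@homothety R C x))) ->
  forall h : {linear C -> I j.+1}, (forall c, d j.+1 (h c) = 0) ->
  exists2 h' : {linear C -> I j.+1}, (forall c, d j.+1 (h' c) = 0) &
    forall c, h c = x *: h' c.
Proof.
move=> xI Qz h hc.
have [l lE] := Iinj h xI.
set S := linim _ in Qz.
have qs : Defs.surjective (qproj S) by exact: qproj_surj.
have [|e eE] := factor_surj (h := d j.+1 \o l) qs.
  move=> y qy; have : qproj S y = qproj S 0 by rewrite qy linear0.
  by move=> /qproj_eq; rewrite subr0 => /asboolP [z <-]; rewrite /= lE hc.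
have [|e' e'E] := Qz e.
  by move=> y; have [z <-] := qs y; rewrite eE (exact_comp0 _ (@dS j.+1)).
have [h1 h1E] := linear_sub_ex l (e' \o qproj S).
exists h1 => c; first by rewrite h1E linearB /= e'E eE subrr.
rewrite h1E scalerBr -!linearZ_LR /= -[l (x *: c)]/(l (homothety x c)) lE.
have -> : qproj S (x *: c) = 0; last by rewrite linear0 subr0.
rewrite -(linear0 (qproj S)); apply/qproj_eq; rewrite subr0.
by apply/asboolP; exists c.
Qed.

(** In degree 0 only the zero map qualifies, so that degree 0 describes Hom(C, omega). *)
Definition coboundary j (C : lmodType R) : {linear C -> I j} -> Prop :=
  match j with
  | 0 => fun h => forall x, h x = 0
  | j'.+1 => fun h => exists k : {linear C -> I j'}, forall x, d j' (k x) = h x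
  end.

(* Ext^j(C, omega) is finitely generated. *)
Definition ext_fin_gen (j : nat) (C : lmodType R) : Prop :=
  exists n (e : 'I_n -> {linear C -> I j}), (forall i x, d j (e i x) = 0) /\
  forall h : {linear C -> I j}, (forall x, d j (h x) = 0) ->
  exists (c : 'I_n -> R) (b : {linear C -> I j}), coboundary b /\
    forall x, h x = \sum_(i < n) c i *: e i x + b x.

Hypothesis noethR : noetherian R.
Hypothesis omega_fg : fin_gen omega.

(** Evaluation at n generators of C embeds the module of homomorphisms in omega^n. *)
Lemma hom_fin_gen (C : lmodType R) : fin_gen C -> fin_gen {linear C -> omega}.
Proof.
move=> [n [v vE]].
have [ev evE] : exists ev : {linear {linear C -> omega} -> {ffun 'I_n -> omega}},
    forall h, ev h = [ffun i => h (v i)].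
  by apply: linear_ex => a h h'; apply/ffunP => i; rewrite !ffunE.
have evI : injective ev.
  move=> h h'; rewrite !evE => /ffunP hh; apply: hom_eq => x.
  have [c ->] := vE x; rewrite !linear_sum; apply: eq_bigr => i _.
  by have := hh i; rewrite !ffunE !linearZ_LR => ->.
apply: fin_gen_sub noethR _ _ _ evI _.
have /fin_genP [s sE] := omega_fg.
apply/fin_genP; exists [seq [ffun j => if j == i then w else 0] | i <- enum 'I_n, w <- s].
move=> T sT x.
have iT i w : [ffun j => if j == i then w else 0] \in T.
  have [f fE] : exists f : {linear omega -> {ffun 'I_n -> omega}},
      forall w, f w = [ffun j => if j == i then w else 0].
    apply: linear_ex => a y z; apply/ffunP => j; rewrite !ffunE.
    by case: ifP; rewrite ?scaler0 ?addr0.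
  have : w \in preimage f T.
    apply: sE => y ys; rewrite inE fE; apply: sT.
    by apply: allpairs_f => //; rewrite mem_enum.
  by rewrite inE fE.
have -> : x = \sum_(i < n) [ffun j => if j == i then x i else 0].
  apply/ffunP => j; rewrite sum_ffunE (bigD1 j) //= ffunE eqxx big1 ?addr0 //.
  by move=> i ij; rewrite ffunE eq_sym (negPf ij).
by apply: rpred_sum => i _; apply: iT.
Qed.

Lemma ext_fin_gen0 (C : lmodType R) : fin_gen C -> ext_fin_gen 0 C.
Proof.
move=> /hom_fin_gen [n [v vE]]; exists n, (fun i => eta \o v i); split.
  by move=> i x /=; rewrite (exact_comp0 _ d0).
move=> h hc; have [|h' h'E] := factor_inj (h := h) etaI.
  by move=> x; apply/d0.
have [c hE] := vE h'; exists c, \0; split=> // x.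
have [ev evE] : exists f : {linear {linear C -> omega} -> omega}, forall g, f g = g x.
  exact: linear_ex.
rewrite -h'E addr0 -evE hE !linear_sum; apply: eq_bigr => i _.
by rewrite !linearZ_LR evE.
Qed.

(** Dimension shifting: the connecting homomorphism from degree j of K to degree j+1 of C is onto,
    so it carries generators to generators. *)
Lemma ext_fin_genS j (K F C : lmodType R) (k : {linear K -> F})
    (p : {linear F -> C}) : short_exact k p -> dual_basis F ->
  ext_fin_gen j K -> ext_fin_gen j.+1 C.
Proof.
move=> [kI kp ps] Fdb [n [e [ec eE]]].
have ext1 i : exists l : {linear F -> I j}, forall x, l (k x) = e i x.
  by exact: Iinj.
have [l lE] := choice ext1.
have fac i : exists h : {linear C -> I j.+1}, forall y, h (p y) = d j (l i y).
  apply: (factor_surj (h := d j \o l i)) => // _ /kp [x <-] /=.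
  by rewrite lE ec.
have [u uE] := choice fac.
exists n, u; split=> [i y|h hc].
  by have [z <-] := ps y; rewrite uE (exact_comp0 _ (@dS j)).
have [g gE] := dual_basis_lift (f := h \o p) (g := d j) Fdb
  (fun x => (dS _).1 (hc (p x))).
have [|c [b [bB gkE]]] := eE (g \o k).
  by move=> x; rewrite /= gE /= (exact_comp0 _ kp) linear0.
have [b' b'E b'd] : exists2 b' : {linear F -> I j},
    forall x, b' (k x) = b x & forall x, d j (b' x) = 0.
  move: b bB {gkE}; case: (j) => [|j'] b /= bB.
    by exists \0 => x /=; rewrite ?bB ?linear0.
  have [t tE] := bB; have [t' t'E] := Iinj t kI.
  by exists (d j' \o t') => x /=; rewrite ?t'E ?tE ?(exact_comp0 _ (@dS j')).
(* This correction of [g] vanishes on K and so descends to C, where its image under [d j] is the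
   required coboundary. *)
have [s sE] : exists s : {linear F -> I j},
    forall x, s x = g x - \sum_(i < n) c i *: l i x - b' x.
  apply: linear_ex => a x y; rewrite (linearP g) (linearP b').
  have -> : \sum_(i < n) c i *: l i (a *: x + y) =
      a *: \sum_(i < n) c i *: l i x + \sum_(i < n) c i *: l i y.
    rewrite scaler_sumr -big_split; apply: eq_bigr => i _ /=.
    by rewrite (linearP (l i)) scalerDr !scalerA mulrC.
  rewrite !scalerBr !opprD [RHS]addrACA; congr (_ + _).
  by rewrite addrACA.
have [|t tE] := factor_surj (h := s) ps.
  move=> _ /kp [x <-]; rewrite sE b'E -[g (k x)]/((g \o k) x) gkE.
  rewrite -addrA -opprD (_ : \sum_(i < n) c i *: l i (k x) = \sum_(i < n) c i *: e i x).
    by rewrite subrr.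
  by apply: eq_bigr => i _; rewrite lE.
exists c, (d j \o t); split; first by exists t.
move=> y; have [x <-] := ps y; rewrite /= tE sE !linearB b'd subr0 gE /=.
rewrite linear_sum (eq_bigr (fun i => d j (c i *: l i x))).
  by rewrite addrC subrK.
by move=> i _; rewrite uE linearZ_LR.
Qed.

Lemma ext_fg j (C : lmodType R) : fin_gen C -> ext_fin_gen j C.
Proof.
elim: j C => [|j IHj] C Cfg; first exact: ext_fin_gen0.
have [n [p ps]] := free_cover Cfg.
apply: (ext_fin_genS (kernel_exact ps) (dual_basis_free _ n)).
apply: IHj; apply: fin_gen_sub noethR _ _ _ (val_inj : injective (@submod_val _ _ _)) _.
exact: dual_basis_fin_gen (dual_basis_free _ n).
Qed.

End InjectiveResolution.

(** * Vanishing of Ext on torsion-free modules *)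

Lemma cokernel_exact (R : comNzRingType) (U V : lmodType R) (f : {linear U -> V}) :
  injective f -> short_exact f (qproj (linim f)).
Proof.
move=> fI; split=> //; last exact: qproj_surj.
move=> y; rewrite -(linear0 (qproj (linim f))) qproj_eq subr0.
by split=> /asboolP.
Qed.

Section Descent.
Variables (R : comNzRingType) (m : ideal R).
Hypotheses (noethR : noetherian R) (localR : local_ring m).
Hypothesis dimR : krull_dim R 1.

(** Stated for Z modulo L inside V because it is applied to cocycles modulo coboundaries, whose
    ambient module of cochains need not be finitely generated. The generators in [s] are eliminated
    one by one. *)
Lemma nakayama (V : lmodType R) (Z L : submodClosed V) (s : seq V) (x : R) :
  x \in m -> {subset s <= Z} ->
  (forall T : submodClosed V, {subset L <= T} -> {subset s <= T} ->
    {subset Z <= T}) ->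
  (forall h, h \in Z -> exists2 h', h' \in Z & h - x *: h' \in L) ->
  {subset Z <= L}.
Proof.
move=> xm; elim: s => [|v s IHs] sZ sE xZ; first by apply: sE.
apply: (IHs _ _ xZ) => [y ys|T LT sT]; first by apply: sZ; rewrite inE ys orbT.
apply: (sE) => // y; rewrite inE => /predU1P [->|/sT //].
have [||W WP] := @prop_submod_ex R V (fun t => exists a, t - a *: v \in T).
- by exists 0; rewrite scale0r subr0 rpred0.
- move=> b t t' [a ta] [a' ta']; exists (b * a + a').
  have -> : b *: t + t' - (b * a + a') *: v =
      b *: (t - a *: v) + (t' - a' *: v).
    by rewrite scalerDl scalerBr scalerA opprD addrACA.
  by rewrite rpredD ?rpredZ.
have TW t : t \in T -> t \in W.
  by move=> tT; apply/WP; exists 0; rewrite scale0r subr0.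
have [h' hZ hL] := xZ v (sZ v (mem_head _ _)).
have /WP [a aT] : h' \in W.
  apply: sE hZ => t; first by move=> /LT /TW.
  rewrite inE => /predU1P [->|/sT /TW //].
  by apply/WP; exists 1; rewrite scale1r subrr rpred0.
have [u uE] : exists u, u * (1 - x * a) = 1.
  by apply: (one_sub_unit noethR localR); rewrite mulrC; apply: idealM.
(* Modulo [T], v is x h' and h' is a v. *)
have vT : (1 - x * a) *: v \in T.
  have -> : (1 - x * a) *: v = (v - x *: h') + x *: (h' - a *: v).
    by rewrite scalerBl scale1r scalerBr scalerA subrKA.
  by rewrite rpredD ?rpredZ // LT.
by rewrite -[v]scale1r -uE -scalerA rpredZ.
Qed.

Variables (omega : lmodType R) (I : nat -> lmodType R).
Variables (d : forall n, {linear I n -> I n.+1}) (eta : {linear omega -> I 0}).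
Hypothesis resI : injective_resolution d eta.
Hypothesis omega_fg : fin_gen omega.
Variable x : R.
Hypotheses (xm : x \in m) (xreg : GRing.lreg x).

Lemma torsionfree_regular (C : lmodType R) :
  torsionfree C -> injective (@homothety R C x).
Proof. by move=> Ctf; apply: linear_inj => c; apply: Ctf. Qed.

Lemma torsionfree_free n : torsionfree {ffun 'I_n -> R^o}.
Proof.
move=> r v rreg /ffunP rv; apply/ffunP => i; have := rv i.
by rewrite !ffunE; apply: lreg0.
Qed.

Lemma torsionfree_sub (A B : lmodType R) (f : {linear A -> B}) :
  injective f -> torsionfree B -> torsionfree A.
Proof.
move=> fI Btf r v rreg rv; apply: fI; rewrite linear0.
by apply: (Btf r) => //; rewrite -linearZ_LR rv linear0.
Qed.

(** A first syzygy is a submodule of a free module, hence torsion-free. *)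
Lemma ext_zero_syzygy j : (forall C : lmodType R, fin_gen C -> torsionfree C ->
  ext_zero d j C) -> forall C : lmodType R, fin_gen C -> ext_zero d j.+1 C.
Proof.
move=> H C Cfg; have [n [p ps]] := free_cover Cfg.
have Fdb := dual_basis_free R n.
apply: (ext_zero_right resI (kernel_exact ps)); last exact: ext_zero_dual_basis resI _ _ Fdb.
have KI : injective (@submod_val _ _ (linker p)) by exact: val_inj.
apply: H; last exact: torsionfree_sub KI (@torsionfree_free n).
by apply: fin_gen_sub noethR _ _ _ KI _; apply: dual_basis_fin_gen.
Qed.

(** The class of 1 in R/xR is nonzero and killed by the regular [x], so some multiple of it has
    annihilator m. *)
Lemma residue_field_embedding :
  exists f : {linear residue_field m -> quotmod (linim (@homothety R R^o x))},
    injective f.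
Proof.
set S := linim _; pose e : quotmod S := qproj S (1 : R^o).
have e0 : e != 0.
  apply/eqP; rewrite -(linear0 (qproj S)) => /qproj_eq; rewrite subr0.
  move=> /asboolP [y xy]; have yx : (y : R) * x = 1 by rewrite mulrC; exact: xy.
  have : (1 : R) \in m by rewrite -yx; apply: idealM.
  by rewrite (negPf localR.1.1).
have xe : x *: e = 0.
  rewrite -(qproj_scalable S x (1 : R^o)) -(linear0 (qproj S)).
  by apply/qproj_eq; rewrite subr0; apply/asboolP; exists 1.
have [c _ cm] := associated_prime_regular noethR localR dimR e0 xreg xe.
have [g gE] := scale_ex (c *: e).
have [|f fE] := factor_surj (h := g) (qproj_surj (S := m)).
  move=> r; rewrite -(linear0 (qproj m)) gE => /qproj_eq; rewrite subr0 -cm.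
  by move=> /annihilatorP.
exists f; apply: linear_inj => q; have [r <-] := qproj_surj q.
rewrite fE gE => /annihilatorP; rewrite cm => rm.
by rewrite -(linear0 (qproj m)); apply/qproj_eq; rewrite subr0.
Qed.

Lemma ext_zero_descent j :
  (forall C : lmodType R, fin_gen C -> torsionfree C -> ext_zero d j.+1 C) ->
  forall C : lmodType R, fin_gen C -> torsionfree C -> ext_zero d j C.
Proof.
move=> IH; have ext2 := ext_zero_syzygy IH.
have Rfg : fin_gen (R^o : lmodType R).
  by apply: noetherian_fin_gen; apply: noetherian_ring_module.
have Rdb : dual_basis (R^o : lmodType R).
  exists 1%N, (fun=> 1), (fun=> idfun) => r.
  by rewrite big_ord1 /GRing.scale /= mulr1.
have xR : injective (@homothety R R^o x) by exact: xreg.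
have extRx : ext_zero d j.+1 (quotmod (linim (@homothety R R^o x))).
  by apply: (ext_zero_right resI (cokernel_exact xR)); apply: ext_zero_dual_basis resI _ _ Rdb.
(* The cokernel of R/m -> R/xR is an arbitrary finitely generated module, which is why [ext2], one
   degree higher, is needed. *)
have extk : ext_zero d j.+1 (residue_field m).
  have [f fI] := residue_field_embedding.
  apply: (ext_zero_left resI (cokernel_exact fI)) => //; apply: ext2.
  apply: (fin_gen_surj (p := qproj _)); first exact: qproj_surj.
  by apply: (fin_gen_surj (p := qproj _)); first exact: qproj_surj.
have ext_tor (V : lmodType R) : fin_gen V -> torsion_module V -> ext_zero d j.+1 V.
  apply: (devissage noethR localR dimR).
  - exact: ext_zero_trivial.
  - by move=> A B f fb; apply: ext_zero_iso fb.
  - by move=> A B f g fg Az; apply: (ext_zero_mid resI fg).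
move=> C Cfg Ctf; have xC := torsionfree_regular Ctf.
(* C/xC is torsion, so x acts surjectively on the finitely generated Ext^(j+1)(C, omega). *)
have divx := ext_divisible resI xC (ext_tor _ _ _).
have [n [e [ec eE]]] := ext_fg resI noethR omega_fg j.+1 Cfg.
have [||Z ZP] := @prop_submod_ex R {linear C -> I j.+1}
  (fun h => forall c, d j.+1 (h c) = 0).
- by move=> c; rewrite /= linear0.
- move=> a h h' hc hc' c; change (d j.+1 (a *: h c + h' c) = 0).
  by rewrite linearP hc hc' scaler0 addr0.
have [||L LP] := @prop_submod_ex R {linear C -> I j.+1}
  (fun h => exists h' : {linear C -> I j}, forall c, d j (h' c) = h c).
- by exists \0 => c; rewrite /= linear0.
- move=> a h h' [k kE] [k' k'E]; exists (a *: k + k') => c.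
  change (d j (a *: k c + k' c) = a *: h c + h' c).
  by rewrite linearP kE k'E.
move=> h hc; apply/LP; apply: (@nakayama _ Z L [seq e i | i : 'I_n] x) => //.
- by move=> _ /imageP [i _ ->]; apply/ZP.
- move=> T LT eT h1 /ZP /eE [c [b [bB h1E]]].
  have -> : h1 = \sum_(i < n) c i *: e i + b.
    apply: hom_eq => y; rewrite h1E.
    have [ev evE] : exists f : {linear {linear C -> I j.+1} -> I j.+1}, forall g, f g = g y.
      exact: linear_ex.
    rewrite -!evE linearD linear_sum; congr (_ + _); apply: eq_bigr => i _.
    by rewrite linearZ_LR evE.
  apply: rpredD; last exact/LT/LP.
  by apply: rpred_sum => i _; apply: rpredZ; apply: eT; apply: image_f.
- move=> h1 /ZP h1c; have [||h' h'c h'E] := divx _ _ h1 h1c.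
  + by apply: (fin_gen_surj (p := qproj _)) Cfg; exact: qproj_surj.
  + move=> q; exists x; split=> //; have [c <-] := qproj_surj q.
    rewrite -qproj_scalable -(linear0 (qproj _)); apply/qproj_eq; rewrite subr0.
    by apply/asboolP; exists c.
  exists h'; first exact/ZP.
  have -> : h1 - x *: h' = 0; last by rewrite rpred0.
  apply: hom_eq => c; change (h1 c - x *: h' c = 0).
  by rewrite h'E subrr.
- exact/ZP.
Qed.

Lemma ext_zero_torsionfree n : (forall i, (n < i)%N -> forall y : I i, y = 0) ->
  forall C : lmodType R, fin_gen C -> torsionfree C -> ext_zero d 0 C.
Proof.
move=> I0; suff H k : (k <= n)%N -> forall C : lmodType R, fin_gen C ->
    torsionfree C -> ext_zero d (n - k) C.
  by move=> C; rewrite -(subnn n); apply: H.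
elim: k => [_ C _ _|k IHk kn]; first by apply: ext_zero_top I0 _ _ _; rewrite subn0.
by apply: ext_zero_descent; rewrite subnSK //; apply: IHk; apply: ltnW.
Qed.

End Descent.

(** * Extensions by tensor products with omega; length *)

Section ModuleExtensions.
Variable R : comNzRingType.

(* Ext^1(C, V) = 0 *)
Definition ext1_zero (C V : lmodType R) : Prop :=
  forall (A B : lmodType R) (f : {linear A -> B}) (g : {linear B -> C}),
  short_exact f g -> forall h : {linear A -> V},
  exists h' : {linear B -> V}, forall x, h' (f x) = h x.

(** Extending [h] with values in I 0 leaves a cocycle on C as obstruction; its primitive corrects
    the extension so that it lands in omega. *)
Lemma ext1_zero_resolution (omega C : lmodType R) (I : nat -> lmodType R)
    (d : forall n, {linear I n -> I n.+1}) (eta : {linear omega -> I 0}) :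
  injective_resolution d eta -> ext_zero d 0 C -> ext1_zero C omega.
Proof.
move=> [Iinj etaI d0 dS] Cz A B f g [fI fg gs] h.
have [l lE] := Iinj 0%N _ _ f (eta \o h) fI.
have [|e eE] := factor_surj (h := d 0 \o l) gs.
  by move=> _ /fg [x <-]; rewrite /= lE /= (exact_comp0 _ d0).
have [|e' e'E] := Cz e.
  by move=> y; have [x <-] := gs y; rewrite eE (exact_comp0 _ (dS 0%N)).
have [t tE] := linear_sub_ex l (e' \o g).
have [|h' h'E] := factor_inj (h := t) etaI.
  by move=> x; apply/d0; rewrite tE linearB /= e'E eE subrr.
exists h' => x; apply: etaI.
by rewrite h'E tE lE /= (exact_comp0 _ fg) linear0 subr0.
Qed.

(** Any extension B of C by A is a quotient of A * P, so one projective presentation of C decides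
    all extension problems. *)
Lemma ext1_zero_presentation (K P C V : lmodType R) (k : {linear K -> P})
    (p : {linear P -> C}) : short_exact k p -> dual_basis P ->
  (forall h : {linear K -> V}, exists h' : {linear P -> V},
     forall x, h' (k x) = h x) -> ext1_zero C V.
Proof.
move=> [kI kp ps] Pdb kV A B f g [fI fg gs] h.
have [u uE] := dual_basis_lift (f := p) (g := g) Pdb (fun x => gs (p x)).
have [|u' u'E] := factor_inj (h := u \o k) fI.
  by move=> x; apply/fg; rewrite /= uE (exact_comp0 _ kp).
have [w wE] := kV (h \o u').
have [s sE] : exists s : {linear (A * P)%type -> B}, forall x, s x = f x.1 + u x.2.
  by apply: linear_ex => a x y; rewrite (linearP f) (linearP u) scalerDr addrACA.
have [t tE] : exists t : {linear (A * P)%type -> V}, forall x, t x = h x.1 + w x.2.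
  by apply: linear_ex => a x y; rewrite (linearP h) (linearP w) scalerDr addrACA.
have [||h' h'E] := factor_surj (p := s) (h := t).
- move=> y; have [q qy] := ps (g y).
  have [x xE] : exists x, f x = y - u q.
    by apply/fg; rewrite linearB uE qy subrr.
  by exists (x, q); rewrite sE /= xE subrK.
- move=> [a q]; rewrite sE tE /= => aq.
  have /kp [z zq] : p q = 0.
    by rewrite -uE -[u q](addKr (f a)) aq addr0 linearN (exact_comp0 _ fg) oppr0.
  have -> : a = - u' z.
    apply: fI; rewrite linearN u'E /= zq.
    by apply/eqP; rewrite -addr_eq0 aq.
  by rewrite linearN -zq wE addNr.
exists h' => x; have := h'E (x, 0).
by rewrite sE tE /= !linear0 !addr0.
Qed.

(** The pullback of F -> V <- D is an extension of D by K; a retraction onto K makes the projection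
    to F descend to D. *)
Lemma ext1_zero_lift (K F V D : lmodType R) (k : {linear K -> F})
    (p : {linear F -> V}) (h : {linear D -> V}) :
  short_exact k p -> ext1_zero D K ->
  exists h' : {linear D -> F}, forall x, p (h' x) = h x.
Proof.
move=> [kI kp ps] DK.
have [df dfE] : exists f : {linear (F * D)%type -> V}, forall x, f x = p x.1 - h x.2.
  apply: linear_ex => a x y.
  by rewrite (linearP p) (linearP h) scalerBr opprD addrACA.
pose B : lmodType R := submod (linker df).
have BP (b : B) : p (submod_val b).1 = h (submod_val b).2.
  by apply/eqP; rewrite -subr_eq0 -dfE; have := submod_valP b; rewrite inE.
have [pr2 pr2E] : exists f : {linear B -> D}, forall b, f b = (submod_val b).2.
  exact: linear_ex.
have [pr1 pr1E] : exists f : {linear B -> F}, forall b, f b = (submod_val b).1.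
  exact: linear_ex.
have mkB x y : p x = h y -> exists b : B, submod_val b = (x, y).
  move=> xy; have xyB : (x, y) \in linker df by rewrite inE dfE xy subrr.
  by exists (Submod xyB).
have [inl inlE] : exists f : {linear K -> (F * D)%type}, forall x, f x = (k x, 0).
  apply: linear_ex => a x y; congr (_, _); first exact: linearP.
  by rewrite /= scaler0 addr0.
have [|j jE] := factor_inj (h := inl) (val_inj : injective (@submod_val _ _ (linker df))).
  by move=> x; rewrite inlE; apply: mkB; rewrite (exact_comp0 _ kp) linear0.
have jpr2 : short_exact j pr2.
  split.
  - by move=> x y /(congr1 (@submod_val _ _ _)); rewrite !jE !inlE => -[/kI].
  - move=> b; rewrite pr2E; split=> [b2|[x <-]]; last by rewrite jE inlE.
    have /kp [x xb] : p (submod_val b).1 = 0 by rewrite BP b2 linear0.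
    by exists x; apply: val_inj; rewrite /= jE inlE xb -b2 -surjective_pairing.
  - by move=> y; have [x /mkB [b bE]] := ps (h y); exists b; rewrite pr2E bE.
have [r rE] := DK _ _ j pr2 jpr2 idfun.
have [t tE] := linear_sub_ex pr1 (k \o r).
have [jI jpr pr2s] := jpr2.
have [|h' h'E] := factor_surj (h := t) pr2s.
  by move=> _ /jpr [x <-]; rewrite tE pr1E jE inlE /= rE subrr.
exists h' => y; have [b <-] := pr2s y.
by rewrite h'E tE linearB /= (exact_comp0 _ kp) subr0 pr1E BP pr2E.
Qed.

Lemma ext1_zero_tensor (omega C P : lmodType R) :
  dual_basis P -> ext1_zero C omega -> ext1_zero C (tensor P omega).
Proof.
move=> [n [b [f bf]]] Cz A B i p ip h.
have [e eE] := choice (fun q => tensor_eval_ex omega (f q)).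
have [l lE] := choice (fun q => Cz _ _ i p ip (e q \o h)).
have [h' h'E] : exists h' : {linear B -> tensor P omega},
    forall x, h' x = \sum_(q < n) tens (b q) (l q x).
  apply: linear_ex => a x y; rewrite scaler_sumr -big_split.
  by apply: eq_bigr => q _; rewrite (linearP (l q)) linearPr.
exists h' => x; rewrite h'E [RHS](tensor_dual_basis bf eE).
by apply: eq_bigr => q _; rewrite lE.
Qed.

(** A map to V from a syzygy of C is first lifted to F (x) omega, the syzygy being torsion-free, and
    then extended to the free module, C being torsion-free. This stands in for the vanishing of
    Ext^2(C, K (x) omega). *)
Lemma ext1_zero_cokernel (omega K F V : lmodType R) (k : {linear K -> F})
    (p : {linear tensor F omega -> V}) : noetherian R ->
  (forall C : lmodType R, fin_gen C -> torsionfree C -> ext1_zero C omega) ->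
  dual_basis K -> dual_basis F -> short_exact (tensor_map omega k) p ->
  forall C : lmodType R, fin_gen C -> torsionfree C -> ext1_zero C V.
Proof.
move=> noethR omega0 Kdb Fdb kp C Cfg Ctf.
have [n [q qs]] := free_cover Cfg.
have ndb := dual_basis_free R n.
have qex := kernel_exact qs.
have KI : injective (@submod_val _ _ (linker q)) by exact: val_inj.
apply: (ext1_zero_presentation qex ndb) => h.
have Dz : ext1_zero (submod (linker q)) (tensor K omega).
  apply: ext1_zero_tensor => //; apply: omega0.
    exact: fin_gen_sub noethR _ _ _ KI (dual_basis_fin_gen ndb).
  exact: torsionfree_sub KI (@torsionfree_free R n).
have [h1 h1E] := ext1_zero_lift h kp Dz.
have [h2 h2E] := ext1_zero_tensor Fdb (omega0 C Cfg Ctf) qex h1.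
by exists (p \o h2) => x; rewrite /= h2E h1E.
Qed.

End ModuleExtensions.

(** * Length of modules *)

Section Length.
Variable R : comNzRingType.
Implicit Types A B C V W : lmodType R.

Definition ascending V (c : nat -> submodClosed V) : Prop :=
  forall i, {subset c i <= c i.+1}.

Definition strict_step V (c : nat -> submodClosed V) i : bool :=
  `[< exists x, x \in c i.+1 /\ x \notin c i >].

(** Chains may repeat and only strict inclusions count, so that images and preimages of chains are
    again chains with the same indices. *)
Definition strict_steps V (c : nat -> submodClosed V) k : nat :=
  (\sum_(i < k) strict_step c i)%N.

Definition length_le V n : Prop :=
  forall c k, @ascending V c -> (strict_steps c k <= n)%N.

Definition finite_length V : Prop := exists n, length_le V n.

Lemma length_le_trivial V : (forall x : V, x = 0) -> length_le V 0.
Proof.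
move=> V0 c k _; rewrite /strict_steps big1 // => i _.
by rewrite /strict_step; case: asboolP => // -[x [_]]; rewrite [x]V0 rpred0.
Qed.

Lemma image_submod_ex V W (g : {linear V -> W}) (S : submodClosed V) :
  exists T : submodClosed W, forall y, y \in T <-> exists2 x, x \in S & g x = y.
Proof.
apply: prop_submod_ex => [|a _ _ [x xS <-] [y yS <-]].
  by exists 0; rewrite ?rpred0 ?linear0.
by exists (a *: x + y); rewrite ?linearP // rpredD ?rpredZ.
Qed.

(** Where both the preimage in A and the image in C stand still, so does the chain in B. *)
Lemma strict_steps_exact A B C (f : {linear A -> B}) (g : {linear B -> C})
    (c : nat -> submodClosed B) k :
  exact_at f g -> ascending c ->
  exists2 c1 : nat -> submodClosed A, ascending c1 &
  exists c2 : nat -> submodClosed C,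
    [/\ ascending c2, forall i y, y \in c2 i -> exists x, g x = y
      & (strict_steps c k <= strict_steps c1 k + strict_steps c2 k)%N].
Proof.
move=> fg casc; have [c2 c2P] := choice (fun i => image_submod_ex g (c i)).
exists (fun i => preimage f (c i) : submodClosed A); first by move=> i x; rewrite !inE; apply: casc.
exists c2; split.
- by move=> i y /c2P [x xc <-]; apply/c2P; exists x => //; apply: casc.
- by move=> i y /c2P [x _ <-]; exists x.
rewrite /strict_steps -big_split; apply: leq_sum => i _ /=.
have [[x [xS xc]]|] := asboolP (exists x, x \in c i.+1 /\ x \notin c i); last first.
  by rewrite /strict_step => /asboolPn /negbTE ->.
rewrite [strict_step c i](asboolT _); last by exists x.
have [/c2P [y yc gxy]|gx] := boolP (g x \in c2 i); last first.
  rewrite [strict_step c2 i](asboolT _) ?leq_addl //.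
  by exists (g x); split=> //; apply/c2P; exists x.
rewrite [strict_step _ i](asboolT _) //.
have [a ax] : exists a, f a = x - y by apply/fg; rewrite linearB gxy subrr.
exists a; rewrite !inE ax; split; first by apply: submodB => //; apply: casc.
by apply: contra xc => xyc; rewrite -[x](subrK y) rpredD.
Qed.

Lemma length_le_exact A B C (f : {linear A -> B}) (g : {linear B -> C}) a b :
  exact_at f g -> length_le A a -> length_le C b -> length_le B (a + b).
Proof.
move=> fg Aa Cb c k casc.
have [c1 c1asc [c2 [c2asc _ le]]] := strict_steps_exact k fg casc.
by apply: leq_trans le _; apply: leq_add; [apply: Aa | apply: Cb].
Qed.

Lemma finite_length_exact A B C (f : {linear A -> B}) (g : {linear B -> C}) :
  exact_at f g -> finite_length A -> finite_length C -> finite_length B.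
Proof.
by move=> fg [a Aa] [b Cb]; exists (a + b)%N; apply: length_le_exact Aa Cb.
Qed.

Lemma finite_length_inj B C (g : {linear B -> C}) :
  injective g -> finite_length C -> finite_length B.
Proof.
move=> gI; apply: (@finite_length_exact (submod (linker g)) _ _ (@submod_val _ _ (linker g)) g).
  move=> y; split=> [gy|[x <-]].
    by exists 0; rewrite linear0; apply: gI; rewrite gy linear0.
  by have := submod_valP x; rewrite inE => /eqP.
exists 0%N; apply: length_le_trivial => x; apply: val_inj; apply: gI.
by have := submod_valP x; rewrite inE => /eqP ->; rewrite !linear0.
Qed.

Lemma length_max V : finite_length V -> exists n, length_le V n /\
  exists c k, @ascending V c /\ strict_steps c k = n.
Proof.
move=> [N VN].
pose P n := `[< exists c k, @ascending V c /\ strict_steps c k = n >].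
have exP : exists n, P n.
  have [||Z ZP] := @prop_submod_ex R V (fun=> True) => //.
  by exists (strict_steps (fun=> Z) 0); apply/asboolP; exists (fun=> Z), 0%N; split=> // i x.
have leP n : P n -> (n <= N)%N by move=> /asboolP [c [k [casc <-]]]; apply: VN.
case: (ex_maxnP exP leP) => n /asboolP nP nmax; exists n; split=> // c k casc.
by apply: nmax; apply/asboolP; exists c, k.
Qed.

(** Through [s], B has a chain with as many strict steps as the lengths of A and C together. If [g]
    missed an element, the image chain in C could be prolonged by C itself, so it would have fewer
    steps than the length of C. *)
Lemma length_surjective A B C (f : {linear A -> B}) (g : {linear B -> C})
    (s : {linear (A * C)%type -> B}) :
  exact_at f g -> injective s -> finite_length A -> finite_length C ->
  Defs.surjective g.
Proof.
move=> fg sI /length_max [a [Aa [c1 [k1 [c1asc c1a]]]]].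
move=> /length_max [b [Cb [c2 [k2 [c2asc c2b]]]]] y; apply: contrapT => yg.
(* The chain of A runs first, during [k1] steps, and then stays at its last term while the chain of
   C runs. *)
have /choice [c cP] i : exists S : submodClosed B, forall z, z \in S <->
    exists x, [/\ x.1 \in c1 (minn i k1), x.2 \in c2 (i - k1)%N & s x = z].
  apply: prop_submod_ex => [|r _ _ [x [x1 x2 <-]] [x' [x1' x2' <-]]].
    by exists 0; split; rewrite /= ?rpred0 ?linear0.
  exists (r *: x + x'); split; last exact: linearP.
    by rewrite /= rpredD ?rpredZ.
  by rewrite /= rpredD ?rpredZ.
have casc : ascending c.
  move=> i z /cP [x [x1 x2 <-]]; apply/cP; exists x; split=> //.
    have [ik|ki] := ltnP i k1.
      by rewrite (minn_idPl ik); apply: c1asc; rewrite -(minn_idPl (ltnW ik)).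
    by rewrite (minn_idPr (leqW ki)); rewrite (minn_idPr ki) in x1.
  have [ik|ki] := ltnP i k1; last by rewrite subSn //; apply: c2asc.
  have -> : (i.+1 - k1 = 0)%N by apply/eqP; rewrite subn_eq0.
  by have <- : (i - k1 = 0)%N by apply/eqP; rewrite subn_eq0 ltnW.
have le1 : (a + b <= strict_steps c (k1 + k2))%N.
  rewrite -c1a -c2b /strict_steps big_split_ord /=; apply: leq_add.
    apply: leq_sum => i _; rewrite /strict_step.
    case: asboolP => // -[x [xS xc]]; rewrite asboolT //.
    have ik := ltn_ord i; exists (s (x, 0)); split.
      by apply/cP; exists (x, 0); rewrite /= (minn_idPl ik) rpred0.
    apply/negP => /cP [z [z1 _ /sI zx]]; case/negP: xc.
    by rewrite zx (minn_idPl (ltnW ik)) in z1.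
  apply: leq_sum => i _; rewrite /strict_step.
  case: asboolP => // -[x [xS xc]]; rewrite asboolT //.
  exists (s (0, x)); split.
    by apply/cP; exists (0, x); rewrite /= -addnS addKn rpred0.
  apply/negP => /cP [z [_ z2 /sI zx]]; case/negP: xc.
  by rewrite zx addKn in z2.
have [e1 e1asc [e2 [e2asc e2g le2]]] := strict_steps_exact (k1 + k2) fg casc.
have [||U UP] := @prop_submod_ex R C (fun=> True) => //.
set k := (k1 + k2)%N in le1 le2.
pose e i : submodClosed C := if (i <= k)%N then e2 i else U.
have easc : ascending e.
  move=> i x; rewrite /e; case: (leqP i.+1 k) => ik; last by move=> _; apply/UP.
  by rewrite (ltnW ik); apply: e2asc.
have := Cb e k.+1 easc; rewrite /strict_steps big_ord_recr /=.
rewrite [strict_step e k](asboolT _); last first.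
  exists y; rewrite /e ltnn leqnn; split; first exact/UP.
  by apply/negP => /e2g.
rewrite (eq_bigr (fun i : 'I_k => strict_step e2 i : nat)); last first.
  by move=> i _; rewrite /strict_step /e (ltnW (ltn_ord i)) (ltn_ord i).
rewrite -/(strict_steps e2 k) addn1 => le3.
have := leq_trans le1 (leq_trans le2 (leq_add (Aa e1 k e1asc) (leqnn _))).
by rewrite leq_add2l leqNgt le3.
Qed.

Variable m : ideal R.
Hypotheses (noethR : noetherian R) (localR : local_ring m).
Hypothesis dimR : krull_dim R 1.

Lemma finite_length_residue : finite_length (residue_field m).
Proof.
exists 1%N => c k casc.
(* The induction also records that after one strict step the chain has reached the whole of R/m. *)
suff [? _] : (strict_steps c k <= 1)%N /\
  (strict_steps c k = 1%N -> forall q, q \in c k) by [].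
elim: k => [|k [le1 IHk]]; first by rewrite /strict_steps big_ord0.
have -> : strict_steps c k.+1 = (strict_steps c k + strict_step c k)%N.
  by rewrite /strict_steps big_ord_recr.
have [cs|] := asboolP (exists x, x \in c k.+1 /\ x \notin c k); last first.
  rewrite /strict_step => /asboolPn /negbTE ->; rewrite addn0; split=> // s1 q.
  exact/casc/IHk.
rewrite [strict_step c k](asboolT cs); have [q [qS qc]] := cs.
have s0 : strict_steps c k = 0%N.
  move: le1; rewrite leq_eqVlt ltnS leqn0 => /orP [/eqP /IHk /(_ q)|/eqP //].
  by rewrite (negPf qc).
rewrite s0; split=> // _.
have [r rq] := qproj_surj q.
have [J JP] := ideal_sum_ex m r.
have rm : r \notin m.
  apply: contra qc => rm; suff -> : q = 0 by rewrite rpred0.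
  by rewrite -rq -(linear0 (qproj m)); apply/qproj_eq; rewrite subr0.
have /JP [a am] : (1 : R) \in J.
  apply: contraT => J1; case/negP: rm; rewrite -(localR.1.2 J J1).
    by apply/JP; exists 1; rewrite mul1r subrr ideal0.
  by move=> x xm; apply/JP; exists 0; rewrite mul0r subr0.
move=> t; have [b <-] := qproj_surj t.
have -> : qproj m b = (b * a) *: q.
  rewrite -rq; apply: etrans (qproj_scalable m (b * a) r); apply/qproj_eq.
  have -> : b - (b * a) *: r = b * (1 - a * r) by rewrite /GRing.scale /=; ring.
  exact: idealM.
exact: rpredZ.
Qed.

Lemma finite_length_torsion V :
  fin_gen V -> torsion_module V -> finite_length V.
Proof.
apply: (devissage noethR localR dimR) => [A A0|A B f fb|A B f g [_ fg _] Af].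
- by exists 0%N; apply: length_le_trivial.
- have [f' fK f'K] := fb; have [f1 f1E] : exists f1 : {linear B -> A}, f1 =1 f'.
    by apply: linear_ex => a x y; apply: (can_inj fK); rewrite linearP !f'K.
  by apply: (finite_length_inj (g := f1)) => x y; rewrite !f1E; apply: (can_inj f'K).
- exact: finite_length_exact fg Af finite_length_residue.
Qed.

(** Devissage in V by left exactness of Hom(-, W); on R/m, evaluation at 1 embeds the homomorphisms
    in W. *)
Lemma finite_length_hom V W : fin_gen V -> torsion_module V ->
  finite_length W -> finite_length {linear V -> W}.
Proof.
move=> Vfg Vtor Wf; move: V Vfg Vtor.
apply: (devissage noethR localR dimR) => [A A0|A B f fb Af|A B f g [fI fg gs] Af].
- exists 0%N; apply: length_le_trivial => h; apply: hom_eq => x.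
  by rewrite [x]A0 !linear0.
- apply: (finite_length_inj (g := @precomp _ _ _ W f)) Af => h h' hh.
  have [f' _ f'K] := fb; apply: hom_eq => x; rewrite -[x]f'K.
  by have := congr1 (fun k : {linear A -> W} => k (f' x)) hh.
apply: (@finite_length_exact _ _ _ (@precomp _ _ _ W g) (@precomp _ _ _ W f)) Af.
  move=> h; split=> [hf|[l <-]].
    have [|l lE] := factor_surj (h := h) gs; last by exists l; apply: hom_eq.
    move=> _ /fg [x <-].
    exact: (congr1 (fun k : {linear A -> W} => k x) hf).
  by apply: hom_eq => x /=; rewrite (exact_comp0 _ fg) linear0.
have [ev evE] : exists ev : {linear {linear residue_field m -> W} -> W},
    forall h, ev h = h (qproj m (1 : R)).
  exact: linear_ex.
apply: (finite_length_inj (g := ev)) Wf => h h'.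
rewrite !evE => hh; apply: hom_eq => q; have [r <-] := qproj_surj q.
have -> : qproj m r = r *: (qproj m (1 : R) : residue_field m).
  apply: etrans (qproj_scalable m r (1 : R)).
  by rewrite /GRing.scale /= mulr1.
by rewrite !linearZ_LR hh.
Qed.

End Length.

(** * Splitting *)

Lemma torsion_quotient_torsionfree (R : comNzRingType) (V : lmodType R) :
  torsionfree (quotmod (@torsion _ V)).
Proof.
move=> r q rreg; have [v <-] := qproj_surj q.
rewrite -qproj_scalable -!(linear0 (qproj (@torsion _ V))) => /qproj_eq.
rewrite subr0 => /asboolP [s [sreg srv]].
apply/qproj_eq; rewrite subr0; apply/asboolP; exists (s * r).
by split; [exact: lregM | rewrite -scalerA].
Qed.

Lemma tor_torsion_module (R : comNzRingType) (V : lmodType R) :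
  torsion_module (tor V).
Proof.
move=> v; have /asboolP [r [rreg rv]] := submod_valP v; exists r; split=> //.
exact: val_inj.
Qed.

Lemma tor_map_ex (R : comNzRingType) (U V : lmodType R) (f : {linear U -> V}) :
  exists tf : {linear tor U -> tor V},
    forall x, submod_val (tf x) = f (submod_val x).
Proof.
apply: (factor_inj (h := f \o @submod_val _ _ (@torsion _ U))
  (val_inj : injective (@submod_val _ _ (@torsion _ V)))) => x.
have fx : f (submod_val x) \in @torsion _ V.
  have /asboolP [r [rreg rx]] := submod_valP x; apply/asboolP; exists r.
  by rewrite -linearZ_LR rx linear0.
by exists (Submod fx).
Qed.

Lemma postcomp_ex (R : comNzRingType) (U V W : lmodType R) (g : {linear V -> W}) :
  exists f : {linear {linear U -> V} -> {linear U -> W}}, forall h x, f h x = g (h x).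
Proof.
have [|f fE] := @linear_ex R {linear U -> V} {linear U -> W} (fun h => g \o h).
  move=> a h h'; apply: hom_eq => x.
  change (g (a *: h x + h' x) = a *: g (h x) + g (h' x)).
  exact: linearP.
by exists f => h x; rewrite fE.
Qed.

(* Hom(T2, T1) -> Hom(T2, T) -> Hom(T2, T2) is exact, and the length of the
   middle term is the sum of the other two, so the identity of T2 lifts. *)
Lemma torsion_section (R : comNzRingType) (m : ideal R) (A1 A A2 : lmodType R)
    (i : {linear A1 -> A}) (p : {linear A -> A2}) :
  noetherian R -> local_ring m -> krull_dim R 1 ->
  fin_gen A1 -> fin_gen A2 -> short_exact i p ->
  isom (tor A) (tor A1 * tor A2)%type ->
  exists s : {linear tor A2 -> A}, forall t, p (s t) = submod_val t.
Proof.
move=> noethR localR dimR A1fg A2fg [iI ip ps] [phi [psi phiK psiK]].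
have [psi1 psi1E] : exists f : {linear (tor A1 * tor A2)%type -> tor A}, f =1 psi.
  by apply: linear_ex => a x y; apply: (can_inj phiK); rewrite linearP !psiK.
have [ti tiE] := tor_map_ex i; have [tp tpE] := tor_map_ex p.
have torfg (V : lmodType R) : fin_gen V -> fin_gen (tor V).
  by apply: fin_gen_sub noethR _ _ _ (val_inj : injective (@submod_val _ _ (@torsion _ V))).
have T1len := finite_length_torsion noethR localR dimR (torfg _ A1fg)
  (@tor_torsion_module _ A1).
have T2len := finite_length_torsion noethR localR dimR (torfg _ A2fg)
  (@tor_torsion_module _ A2).
have homlen := finite_length_hom noethR localR dimR (torfg _ A2fg)
  (@tor_torsion_module _ A2).
have [f fE] := postcomp_ex (tor A2) ti.
have [g gE] := postcomp_ex (tor A2) tp.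
have fg : exact_at f g.
  move=> h; split=> [gh|[l <-]]; last first.
    apply: hom_eq => x; rewrite gE fE; apply: val_inj.
    by rewrite /= tpE tiE (exact_comp0 _ ip).
  have tiI : injective ti.
    by move=> x y /(congr1 (@submod_val _ _ _)); rewrite !tiE => /iI /val_inj.
  have [|l lE] := factor_inj (h := h) tiI.
    move=> x; have /ip [y yh] : p (submod_val (h x)) = 0.
      by rewrite -tpE -gE gh.
    have yT : y \in @torsion _ A1.
      have /asboolP [r [rreg rh]] := submod_valP (h x); apply/asboolP; exists r.
      by split=> //; apply: iI; rewrite linearZ_LR yh rh linear0.
    by exists (Submod yT); apply: val_inj; rewrite /= tiE.
  by exists l; apply: hom_eq => x; rewrite fE.
have pairE (uv : {linear tor A2 -> tor A1} * {linear tor A2 -> tor A2}) :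
    exists w : {linear tor A2 -> tor A}, forall x, w x = psi1 (uv.1 x, uv.2 x).
  apply: linear_ex => a x y.
  rewrite (linearP uv.1) (linearP uv.2).
  exact: (linearP psi1 a (uv.1 x, uv.2 x) (uv.1 y, uv.2 y)).
(* The given isomorphism enters only here, to embed Hom(T2, T1) * Hom(T2, T2) in Hom(T2, T). *)
have [s0 s0E] := choice pairE.
have [s sE] : exists s : {linear ({linear tor A2 -> tor A1}
    * {linear tor A2 -> tor A2})%type -> {linear tor A2 -> tor A}}, s =1 s0.
  apply: linear_ex => a uv uv'; apply: hom_eq => x.
  change (s0 (a *: uv + uv') x = a *: s0 uv x + s0 uv' x).
  rewrite !s0E; exact: (linearP psi1 a (uv.1 x, uv.2 x) (uv'.1 x, uv'.2 x)).
have sI : injective s.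
  move=> [u v] [u' v'] /= uv.
  have uvx x : (u x, v x) = (u' x, v' x).
    have := congr1 (fun k : {linear tor A2 -> tor A} => k x) uv.
    by rewrite !sE !s0E !psi1E => /(can_inj psiK).
  by congr (_, _); apply: hom_eq => x; have [] := uvx x.
have /(_ idfun) [h hE] := length_surjective fg sI (homlen _ T1len) (homlen _ T2len).
exists (@submod_val _ _ (@torsion _ A) \o h) => t.
by rewrite /= -tpE -gE hE.
Qed.

(** On the preimage of the torsion of A2, the map x - s (p x) lands in A1 and is a retraction; the
    vanishing of Ext^1 extends it to A, and a retraction of [i] yields a section of [p]. *)
Lemma torsion_section_split (R : comNzRingType) (A1 A A2 : lmodType R)
    (i : {linear A1 -> A}) (p : {linear A -> A2}) (s : {linear tor A2 -> A}) :
  short_exact i p -> (forall t, p (s t) = submod_val t) ->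
  ext1_zero (quotmod (@torsion _ A2)) A1 -> split_sequence i p.
Proof.
move=> ipex ps_id A1z; have [iI ip ps] := ipex; split=> //.
pose g : {linear A -> quotmod (@torsion _ A2)} := qproj (@torsion _ A2) \o p.
have gs : Defs.surjective g.
  by move=> q; have [y <-] := qproj_surj q; have [x <-] := ps y; exists x.
have gex := kernel_exact gs.
have pT (x : submod (linker g)) : p (submod_val x) \in @torsion _ A2.
  have := submod_valP x; rewrite inE => /eqP /= gx.
  have : qproj (@torsion _ A2) (p (submod_val x)) = qproj _ 0 by rewrite gx linear0.
  by move=> /qproj_eq; rewrite subr0.
have [|t tE] := factor_inj (h := p \o @submod_val _ _ (linker g))
    (val_inj : injective (@submod_val _ _ (@torsion _ A2))).
  by move=> x; exists (Submod (pT x)).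
have [h0 h0E] := linear_sub_ex (@submod_val _ _ (linker g)) (s \o t).
have [|h hE] := factor_inj (h := h0) iI.
  by move=> x; apply/ip; rewrite h0E linearB /= ps_id tE subrr.
have [r rE] := A1z _ _ _ _ gex h.
have ri x : r (i x) = x.
  have ix : i x \in linker g by rewrite inE /= (exact_comp0 _ ip) linear0.
  have := rE (Submod ix); rewrite /= => ->.
  apply: iI; rewrite hE h0E /=.
  have -> : t (Submod ix) = 0.
    by apply: val_inj; rewrite /= tE /= (exact_comp0 _ ip).
  by rewrite linear0 subr0.
have [k kE] := linear_sub_ex idfun (i \o r).
have [|l lE] := factor_surj (h := k) ps.
  by move=> _ /ip [x <-]; rewrite kE /= ri subrr.
exists l => y; have [x <-] := ps y.
by rewrite lE kE linearB /= (exact_comp0 _ ip) subr0.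
Qed.

Theorem proposition3p17 (R : comNzRingType) (m : ideal R)
    (omega M1 M M2 : lmodType R)
    (i : {linear M1 -> M}) (p : {linear M -> M2}) :
  noetherian R -> local_ring m -> krull_dim R 1 -> cohen_macaulay_ring m ->
  canonical_module m omega ->
  fin_gen M1 -> fin_gen M -> fin_gen M2 ->
  projdim_le M1 1 -> projdim_le M 1 -> projdim_le M2 1 ->
  short_exact i p ->
  short_exact (tensor_map omega i) (tensor_map omega p) /\
  (isom (tor (tensor M omega)) (tor (tensor M1 omega) * tor (tensor M2 omega))%type ->
   split_sequence (tensor_map omega i) (tensor_map omega p)).
Proof.
move=> noethR localR dimR cmR [mcm _ [n injn]] M1fg Mfg M2fg pd1 _ pd2 ipex.
have [x xm xreg] := cm_ring_regular dimR cmR.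
have ofg := mcm.1.
have [z zm zI] := maximal_cm_regular dimR mcm.
have otf := regular_torsionfree noethR localR dimR zm zI.
have tinj (K F : lmodType R) (k : {linear K -> F}) :
    dual_basis K -> dual_basis F -> injective k -> injective (tensor_map omega k).
  by move=> *; apply: (tensor_map_injective noethR localR dimR xm xreg).
have [K2 [F2 [k2 [q2 [K2db F2db kq2]]]]] := projdim1_presentation noethR M2fg pd2.
have ztex : short_exact (tensor_map omega i) (tensor_map omega p).
  have [k2I _ _] := kq2.
  exact: tensor_short_exact F2db kq2 (tinj _ _ _ K2db F2db k2I) ipex.
split=> // torE.
have [s sE] := torsion_section noethR localR dimR (tensor_fin_gen M1fg ofg)
  (tensor_fin_gen M2fg ofg) ztex torE.
apply: (torsion_section_split ztex sE).
(* The presentation of M2 served exactness; that of M1 exhibits M1 (x) omega as the cokernel to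
   which the vanishing applies. *)
have [K1 [F1 [k1 [q1 [K1db F1db [k1I kq1 q1s]]]]]] :=
  projdim1_presentation noethR M1fg pd1.
have [I [d [eta [resI I0]]]] := injn.
apply: (ext1_zero_cokernel noethR _ K1db F1db (k := k1) (p := tensor_map omega q1)).
- move=> C Cfg Ctf; apply: (ext1_zero_resolution resI).
  exact: (ext_zero_torsionfree noethR localR dimR resI ofg xm xreg I0).
- split; [exact: tinj | exact: tensor_right_exact | exact: tensor_map_surj].
- apply: (fin_gen_surj (p := qproj (@torsion _ _))); first exact: qproj_surj.
  exact: tensor_fin_gen.
- exact: torsion_quotient_torsionfree.
Qed.
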